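(* Let $G$ be a compactly generated TDLC group, and let $\mathcal H=\{H_1,\dots,H_n\}$ be a finite collection of compactly generated open subgroups of $G$. If $G$ is hyperbolic relative to $\mathcal H$, then the following hold: (1) For all $i\neq j$, $H_i\cap H_j$ is compact. In particular, $\bigcap_{i=1}^n H_i$ is compact. (2) For $g\notin H_i$, $gH_ig^{-1}\cap H_j$ is compact, for all $i$ and $j$. (3) If $H_i$ is hyperbolic for all $i=1,\dots,n$, then $G$ is hyperbolic.
   Context: All topological groups are Hausdorff. A TDLC group is a totally disconnected locally compact group. A topological group is compactly generated if it is algebraically generated by a compact subset. All graphs are connected and edges have length one. A Cayley-Abels graph of a compactly generated TDLC group $G$ is a locally finite connected graph on which $G$ acts, transitively on vertices, with compact open vertex stabilizers (it exists and is unique up to quasiisometry). A compactly generated TDLC group is hyperbolic if some (hence any) Cayley-Abels graph of it is Gromov hyperbolic. For a TDLC group $G$ and a finite collection $\mathcal H$ of open subgroups, $(G,\mathcal H)$ is a proper pair if no two distinct non-compact subgroups in $\mathcal H$ are conjugate in $G$. A Cayley-Abels graph of $G$ with respect to $\mathcal H$ (for a proper pair) is a connected simplicial graph $X$ on which $G$ acts cocompactly and discretely (pointwise stabilizers of cells are open subgroups) such that: (i) edge $G$-stabilizers are compact; (ii) vertex $G$-stabilizers are either compact or conjugates of subgroups in $\mathcal H$; (iii) every $H\in\mathcal H$ is the $G$-stabilizer of a vertex of $X$; (iv) any two vertices of $X$ with the same $G$-stabilizer $H\in\mathcal H$ are in the same $G$-orbit if $H$ is non-compact. A simplicial graph is fine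 if for any vertices $u,v$ and any $n\in\mathbb N$ there are only finitely many embedded paths of length $n$ from $u$ to $v$. $G$ is hyperbolic relative to $\mathcal H$ if $(G,\mathcal H)$ is a proper pair and there exists a Cayley-Abels graph of $G$ with respect to $\mathcal H$ that is fine and Gromov hyperbolic.
   Formalization: The subgroups H_1,…,H_n are taken pairwise distinct, and the claim that the intersection of all H_i is compact is stated only for n ≥ 2, since it fails for n = 1 (for example for the collection {G} with G non-compact). *)

(* Defs.v *)
From HB Require Import structures.
From mathcomp Require Import all_boot all_order.
From mathcomp Require Import all_classical topology.

Set Implicit Arguments.
Unset Strict Implicit.
Unset Printing Implicit Defensive.

Local Open Scope classical_set_scope.
Local Open Scope group_scope.

HB.mixin Record isTopologicalGroup G of Group G & Topological G := {
  mulg_continuous : continuous (fun p : G * G => p.1 * p.2);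
  invg_continuous : continuous (fun g : G => g^-1)
}.

#[short(type="topologicalGroupType")]
HB.structure Definition TopologicalGroup :=
  {G of isTopologicalGroup G & Group G & Topological G}.

Definition is_subgroup (G : groupType) (A : set G) : Prop :=
  [/\ A 1, (forall x y, A x -> A y -> A (x * y)) & (forall x, A x -> A x^-1)].

Record subgroup (G : groupType) := Subgroup {
  subgroup_set :> set G;
  subgroupP : is_subgroup subgroup_set
}.

(* A named copy of the sigma type of elements of [H], so that it can carry both
   the group structure of [G] and the subspace topology. *)
Definition subgroup_type (G : groupType) (H : subgroup G) : Type :=
  set_type (subgroup_set H).

Section SubgroupGroup.
Context (G : groupType) (H : subgroup G).

Fact subgroup_group_closed : group_closed (fun x : G => x \in (H : set G)).
Proof.
have [H1 HM HV] := subgroupP H.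
split; first exact: mem_set.
by move=> x y /set_mem Hx /set_mem Hy; apply/mem_set/HM => //; apply: HV.
Qed.

HB.instance Definition _ :=
  SubChoice.copy (subgroup_type H) {x : G | x \in (H : set G)}.
HB.instance Definition _ :=
  SubChoice_isSubGroup.Build G (fun x : G => x \in (H : set G))
    (subgroup_type H) subgroup_group_closed.
End SubgroupGroup.

HB.instance Definition _ (G : topologicalGroupType) (H : subgroup G) :=
  Topological.copy (subgroup_type H) (set_type (subgroup_set H)).

Section SubgroupTopologicalGroup.
Context (G : topologicalGroupType) (H : subgroup G).

Let subgroup_val (x : subgroup_type H) : G := val x.

Let subgroup_val_continuous : continuous subgroup_val.
Proof. exact: (@initial_continuous (set_type (subgroup_set H)) G set_val). Qed.

Let continuous_subgroup (T : topologicalType) (f : T -> subgroup_type H) :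
  continuous (subgroup_val \o f) -> continuous f.
Proof. exact: continuous_comp_initial. Qed.

Fact subgroup_mulg_continuous :
  continuous (fun p : subgroup_type H * subgroup_type H => p.1 * p.2).
Proof.
apply: continuous_subgroup => p.
apply: (@continuous_comp _ _ _
  (fun p : subgroup_type H * subgroup_type H =>
     (subgroup_val p.1, subgroup_val p.2)) (fun q : G * G => q.1 * q.2));
  last exact: mulg_continuous.
apply: cvg_pair => /=; apply: continuous_cvg;
  by [exact: subgroup_val_continuous | exact: cvg_fst | exact: cvg_snd].
Qed.

Fact subgroup_invg_continuous :
  continuous (fun x : subgroup_type H => x^-1).
Proof.
apply: continuous_subgroup => x.
apply: (@continuous_comp _ _ _ subgroup_val (fun g : G => g^-1));
  [exact: subgroup_val_continuous | exact: invg_continuous].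
Qed.

HB.instance Definition _ :=
  isTopologicalGroup.Build (subgroup_type H)
    subgroup_mulg_continuous subgroup_invg_continuous.

End SubgroupTopologicalGroup.

Definition tdlc (G : topologicalGroupType) : Prop :=
  [/\ hausdorff_space G, totally_disconnected [set: G]
    & locally_compact [set: G]].

Definition compactly_generated (G : topologicalGroupType) : Prop :=
  exists2 K : set G, compact K & smallest (@is_subgroup G) K = setT.

Definition conj_set (G : groupType) (g : G) (A : set G) : set G :=
  [set g * x * g^-1 | x in A].

Record graph := Graph {
  vertex :> choiceType;
  adj : rel vertex;
  adj_sym : symmetric adj;
  adj_irrefl : irreflexive adj
}.
Arguments adj {g}.

Section GraphNotions.
Context (X : graph).
Implicit Types (x y z u v : X) (p q r : seq X) (n d : nat).

(* The walk x, p_1, ..., p_n, of length [size p], ends at y. *)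
Definition walk x y p : bool := path adj x p && (last x p == y).

Definition embedded_path x y p : bool := walk x y p && uniq (x :: p).

(* The empty graph is excluded: it would otherwise be a hyperbolic graph with
   a vacuously transitive action of any group. *)
Definition connected_graph : Prop :=
  inhabited X /\ forall x y, exists p, walk x y p.

Definition locally_finite : Prop := forall x, finite_set [set y | adj x y].

Definition geodesic x y p : Prop :=
  walk x y p /\ forall q, walk x y q -> (size p <= size q)%N.

Definition within_dist d x y : Prop :=
  exists2 p, walk x y p & (size p <= d)%N.

(* Uniformly slim geodesic triangles, with respect to the path metric in which
   edges have length one; corners and side points range over vertices, which
   only affects the constant. *)
Definition gromov_hyperbolic : Prop :=
  exists d, forall x y z p q r,
    geodesic x y p -> geodesic y z q -> geodesic x z r ->
    forall u, u \in x :: p ->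
      exists2 v, v \in (y :: q) ++ (x :: r) & within_dist d u v.

Definition fine : Prop :=
  forall x y n, finite_set [set p | embedded_path x y p /\ size p = n].

End GraphNotions.

Section GraphActions.
Context (G : topologicalGroupType) (X : graph) (act : G -> X -> X).

Definition graph_action : Prop :=
  [/\ (forall x, act 1 x = x),
      (forall g h x, act (g * h) x = act g (act h x))
    & (forall g x y, adj (act g x) (act g y) = adj x y)].

Definition vertex_stab (x : X) : set G := [set g | act g x = x].

(* The stabilizer of an edge as a set: inversions are allowed. *)
Definition edge_stab (x y : X) : set G :=
  [set g | [set act g x; act g y] = [set x; y]].

Definition same_orbit (x y : X) : Prop := exists g, act g x = y.

Definition vertex_transitive : Prop := forall x y, same_orbit x y.

(* Finitely many orbits of cells, i.e. of vertices and of edges. *)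
Definition cocompact_action : Prop :=
  (exists s : seq X, forall x, exists g, act g x \in s) /\
  (exists s : seq (X * X),
     forall x y, adj x y -> exists g, (act g x, act g y) \in s).

Definition discrete_action : Prop :=
  (forall x, open (vertex_stab x)) /\
  (forall x y, adj x y -> open (vertex_stab x `&` vertex_stab y)).

Definition cayley_abels : Prop :=
  [/\ connected_graph X, locally_finite X, graph_action, vertex_transitive
    & forall x, compact (vertex_stab x) /\ open (vertex_stab x)].

Record rel_cayley_abels (HH : set (subgroup G)) : Prop := {
  rca_connected : connected_graph X;
  rca_action : graph_action;
  rca_cocompact : cocompact_action;
  rca_discrete : discrete_action;
  rca_edge_stab : forall x y, adj x y -> compact (edge_stab x y);
  rca_vertex_stab : forall x, compact (vertex_stab x) \/
    exists2 H : subgroup G, HH H & exists g, vertex_stab x = conj_set g H;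
  rca_peripheral : forall H : subgroup G, HH H ->
    exists x, vertex_stab x = H;
  rca_orbit : forall (H : subgroup G) x y, HH H -> ~ compact (H : set G) ->
    vertex_stab x = H -> vertex_stab y = H -> same_orbit x y
}.

End GraphActions.

Definition hyperbolic_group (G : topologicalGroupType) : Prop :=
  exists (X : graph) (act : G -> X -> X),
    cayley_abels act /\ gromov_hyperbolic X.

Definition proper_pair (G : topologicalGroupType) (HH : set (subgroup G)) :
    Prop :=
  [/\ finite_set HH, (forall H : subgroup G, HH H -> open (H : set G))
    & forall H K : subgroup G, HH H -> HH K -> (H : set G) <> K ->
      ~ compact (H : set G) -> ~ compact (K : set G) ->
      ~ exists g, conj_set g H = K].

Definition relatively_hyperbolic (G : topologicalGroupType)
    (HH : set (subgroup G)) : Prop :=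
  proper_pair HH /\
  exists (X : graph) (act : G -> X -> X),
    [/\ rel_cayley_abels act HH, fine X & gromov_hyperbolic X].

(* Main.v *)
(** Two distinct vertices u, v of a fine graph X are joined by finitely many
    geodesics, so their common stabilizer is covered by finitely many cosets
    of edge stabilizers and is compact; this gives (1) and (2).

    For (3), hyperbolicity is replaced by a dual linear isoperimetric
    inequality: every integer 1-cochain w whose sums along short closed walks
    are bounded is, up to a bounded error, the coboundary of a function.
    Slim triangles imply it, because a closed walk always has a shortcut of
    bounded length.  Conversely, applying it to w = f dg - g df with f, g
    truncated distance functions shows that a geodesic quadrilateral of
    perimeter L whose pairs of opposite sides are at distances d1 and d2
    satisfies d1 d2 <= C L, which forces triangles to be slim.

    The inequality passes from the H_i to G.  Lift each oriented edge of X to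
    an element of G, equivariantly up to bounded error, and let w be such a
    cochain on G.  On the coset of lifts of the edges leaving a vertex v, w is
    nearly the coboundary of some f_v, and correcting by the f_v turns w into a
    cochain on the edges of X.  By fineness there are finitely many orbits of
    circuits of bounded length in X, so the corrected cochain is bounded on
    them, and hyperbolicity of X makes it nearly a coboundary; hence so is w. *)

Require Import Defs.
From HB Require Import structures.
From mathcomp Require Import all_boot all_order finmap.
From mathcomp Require Import all_classical topology.
From mathcomp Require Import ssralg ssrnum ssrint zify.

Set Implicit Arguments.
Unset Strict Implicit.
Unset Printing Implicit Defensive.

Local Open Scope classical_set_scope.
Import Order.TTheory GRing.Theory Num.Theory.

Local Open Scope group_scope.

(** * Walks and distances *)

Section Walks.
Context (X : graph).
Implicit Types (x y z u v : X) (p q r : seq X).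

Lemma walk_nil x y : walk x y [::] = (x == y).
Proof. by []. Qed.

Lemma walk_cons x y v p : walk x y (v :: p) = adj x v && walk v y p.
Proof. by rewrite /walk /= andbA. Qed.

Lemma walk_last x y p : walk x y p -> last x p = y.
Proof. by case/andP=> _ /eqP. Qed.

Lemma walk_cat x z p q :
  walk x z (p ++ q) = walk x (last x p) p && walk (last x p) z q.
Proof. by rewrite /walk cat_path last_cat eqxx andbT andbA. Qed.

Lemma walk_trans x y z p q : walk x y p -> walk y z q -> walk x z (p ++ q).
Proof. by move=> wp wq; rewrite walk_cat (walk_last wp) wp wq. Qed.

Lemma walk_rev x y p : walk x y p ->
  exists q, [/\ walk y x q, size q = size p & y :: q =i x :: p].
Proof.
case/andP=> pp /eqP <-; exists (rev (belast x p)); split.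
- rewrite /walk (@sub_path _ (fun u v : X => adj v u)) ?rev_path //=.
    by case: p {pp} => //= v p; rewrite rev_cons last_rcons.
  by move=> u v; rewrite adj_sym.
- by rewrite size_rev size_belast.
- move=> u; rewrite (_ : _ :: _ = rev (x :: p)) ?mem_rev //.
  by rewrite [x :: p]lastI rev_rcons.
Qed.

Lemma walk_subseq x y p u : walk x y p -> u \in x :: p ->
  exists p1 p2, [/\ p = p1 ++ p2, walk x u p1 & walk u y p2].
Proof.
move=> + up; case/splitPl: up => p1 p2 lu; rewrite walk_cat lu => /andP[w1 w2].
by exists p1, p2.
Qed.

(* Junk value [0] when there is no walk from [x] to [y]. *)
Definition dist x y : nat :=
  if pselect (exists n, `[< exists2 p, walk x y p & size p = n >]) is left e
  then ex_minn e else 0.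

Hypothesis Xconn : connected_graph X.

Lemma dist_geodesic x y : exists2 p, walk x y p & size p = dist x y.
Proof.
rewrite /dist; case: pselect => [e|[]].
  by case: ex_minnP => m /asboolP.
have [p wp] := Xconn.2 x y.
by exists (size p); apply/asboolP; exists p.
Qed.

Lemma dist_le x y p : walk x y p -> dist x y <= size p.
Proof.
move=> wp; rewrite /dist; case: pselect => // e.
by case: ex_minnP => m _; apply; apply/asboolP; exists p.
Qed.

Lemma geodesicE x y p : geodesic x y p <-> walk x y p /\ size p = dist x y.
Proof.
split=> [[wp minp]|[wp sp]]; split=> //; last by move=> q /dist_le; rewrite sp.
have [q wq sq] := dist_geodesic x y.
by apply/eqP; rewrite eqn_leq dist_le // -sq minp.
Qed.

Lemma distxx x : dist x x = 0.
Proof. by apply/eqP; rewrite -leqn0 (@dist_le _ _ [::]) //= walk_nil. Qed.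

Lemma dist_eq0 x y : dist x y = 0 -> x = y.
Proof.
move=> d0; have [p wp] := dist_geodesic x y.
by rewrite d0 => /size0nil p0; move: wp; rewrite p0 walk_nil => /eqP.
Qed.

Lemma dist_trans x y z : dist x z <= dist x y + dist y z.
Proof.
have [p wp <-] := dist_geodesic x y; have [q wq <-] := dist_geodesic y z.
by rewrite -size_cat dist_le // (walk_trans wp).
Qed.

Lemma dist_sym x y : dist x y = dist y x.
Proof.
have le u v : dist u v <= dist v u.
  have [p wp <-] := dist_geodesic v u.
  by have [q [wq <- _]] := walk_rev wp; exact: dist_le.
by apply/eqP; rewrite eqn_leq !le.
Qed.

Lemma dist_adj x y : adj x y -> dist x y <= 1.
Proof. by move=> a; rewrite (@dist_le _ _ [:: y]) // walk_cons a walk_nil eqxx. Qed.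

Lemma within_distE d x y : within_dist d x y <-> dist x y <= d.
Proof.
split=> [[p wp sp]|le]; first by rewrite (leq_trans (dist_le wp)).
by have [p wp sp] := dist_geodesic x y; exists p; rewrite ?sp.
Qed.

Lemma geodesic_mem x y p u : geodesic x y p -> u \in x :: p ->
  dist x u + dist u y = dist x y.
Proof.
move=> /geodesicE[wp sp] /(walk_subseq wp)[p1 [p2 [pE w1 w2]]].
move: (dist_le w1) (dist_le w2) (dist_trans x u y).
by rewrite -sp pE size_cat; lia.
Qed.

Lemma walk_mem_dist x y p u : walk x y p -> u \in x :: p ->
  dist x u + dist u y <= size p.
Proof.
move=> wp /(walk_subseq wp)[p1 [p2 [-> /dist_le le1 /dist_le le2]]].
by rewrite size_cat leq_add.
Qed.

End Walks.

Section Geodesics.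
Context (X : graph).
Implicit Types (x y z u v : X) (p q r : seq X).
Hypothesis Xconn : connected_graph X.
Let nthw x p i := nth x (x :: p) i.

Lemma nth_walk_adj x y p i : walk x y p -> i < size p ->
  adj (nthw x p i) (nthw x p i.+1).
Proof. by case/andP=> /(pathP x) h _ /h. Qed.

Lemma last_take x p k : k <= size p -> last x (take k p) = nthw x p k.
Proof.
move=> kp; rewrite /nthw (last_nth x) size_takel //.
by case: k kp => //= k kp; rewrite nth_take.
Qed.

(* From the vertex of index [i] of [x :: p], itself not listed, to that of
   index [j]. *)
Definition subwalk p i j := take (j - i) (drop i p).

Lemma subwalkP x y p i j : walk x y p -> i <= j <= size p ->
  [/\ walk (nthw x p i) (nthw x p j) (subwalk p i j),
      size (subwalk p i j) = j - i
    & p = take i p ++ subwalk p i j ++ drop j p].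
Proof.
move=> wp /andP[ij jp].
have E : p = take i p ++ subwalk p i j ++ drop j p.
  rewrite -{1}(cat_take_drop i p) -{1}(cat_take_drop (j - i) (drop i p)).
  by rewrite drop_drop subnK.
have S : size (subwalk p i j) = j - i by rewrite size_takel // size_drop leq_sub2r.
split=> //.
move: wp; rewrite {1}E walk_cat => /andP[_].
rewrite walk_cat => /andP[+ _].
rewrite last_take ?(leq_trans ij) // => w.
suff <- : last (nthw x p i) (subwalk p i j) = nthw x p j by [].
rewrite -!last_take ?(leq_trans ij) // -last_cat /subwalk.
by rewrite -[in RHS](subnKC ij) takeD.
Qed.

Lemma subwalk_mem x p i j u : i <= j <= size p ->
  u \in nthw x p i :: subwalk p i j -> exists2 k, i <= k <= j & u = nthw x p k.
Proof.
move=> ij us; have := nth_index x us.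
have : index u (nthw x p i :: subwalk p i j) <= j - i.
  have := us; rewrite -index_mem /= size_takel // size_drop; lia.
case: index => [|m] /= mji <-; first by exists i => //; lia.
exists (i + m.+1); first by lia.
by rewrite nth_take // nth_drop addnS.
Qed.

Lemma geodesic_nth x y p i j : geodesic x y p -> i <= j <= size p ->
  dist (nthw x p i) (nthw x p j) = j - i.
Proof.
move=> /(geodesicE Xconn)[wp sp] ijp; have [w s E] := subwalkP wp ijp.
have [/andP[ij jp]] := ijp.
apply/eqP; rewrite eqn_leq -{1}s dist_le //=.
have [|w1 s1 _] := @subwalkP x y p 0 i wp; first by lia.
have [|w2 s2 _] := @subwalkP x y p j (size p) wp; first by lia.
move: (dist_le w1) (dist_le w2); rewrite s1 s2.
have -> : nthw x p 0 = x by [].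
have -> : nthw x p (size p) = y by rewrite /nthw -last_nth; exact: walk_last wp.
move: (dist_trans Xconn x (nthw x p i) y) (dist_trans Xconn (nthw x p i) (nthw x p j) y).
lia.
Qed.

End Geodesics.

(** * Hyperbolic graphs satisfy the dual isoperimetric inequality *)

Section Cochains.
Context (X : graph).
Implicit Types (x y z u v : X) (p q r : seq X) (w : X -> X -> int).
Local Open Scope ring_scope.

Fixpoint walk_sum w x p : int :=
  if p is y :: p' then w x y + walk_sum w y p' else 0.

Definition alternating (T : Type) (w : T -> T -> int) :=
  forall x y : T, w x y = - w y x.

Lemma walk_sum_cat w x p q :
  walk_sum w x (p ++ q) = walk_sum w x p + walk_sum w (last x p) q.
Proof. by elim: p x => [|y p IH] x /=; [rewrite add0r | rewrite IH addrA]. Qed.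

Lemma walk_sum_rev w x y p : alternating w -> walk x y p ->
  exists q, [/\ walk y x q, size q = size p & walk_sum w y q = - walk_sum w x p].
Proof.
move=> alt; elim: p x => [|v p IH] x.
  by rewrite walk_nil => /eqP ->; exists [::]; rewrite walk_nil eqxx /= oppr0.
rewrite walk_cons => /andP[xv /IH[q [wq sq eq]]].
exists (q ++ [:: x]); split.
- by apply: walk_trans wq _; rewrite walk_cons adj_sym xv walk_nil eqxx.
- by rewrite size_cat sq addn1.
- by rewrite walk_sum_cat eq (walk_last wq) /= addr0 (alt v x) opprD addrC.
Qed.

Definition linear_bound w (C : nat) :=
  forall x p, walk x x p -> `|walk_sum w x p| <= (C * size p)%N%:Z.

Hypothesis Xconn : connected_graph X.

(** The value at [y] is the least cost of a walk from a base point, each step costing its [w]-value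
    plus [C]. Minimality along an edge and along its reverse gives the estimate. *)
Lemma potential w (C : nat) : alternating w -> linear_bound w C ->
  exists f : X -> int, forall x y, adj x y -> `|w x y - (f y - f x)| <= C%:Z.
Proof.
move=> alt bnd; have [[x0] _] := Xconn.
pose cost p : int := walk_sum w x0 p + (C * size p)%N%:Z.
have /choice[f fP] y : exists m : int,
    (exists2 p, walk x0 y p & m = cost p) /\
    (forall p, walk x0 y p -> m <= cost p).
  have [q wq] := Xconn.2 y x0.
  (* By the linear bound, a fixed return walk from [y] keeps all costs at least [- d]; shifted by
     [d], they have a least value among the naturals. *)
  pose d : int := walk_sum w y q + (C * size q)%N%:Z.
  have pos p : walk x0 y p -> 0 <= cost p + d.
    move=> wp; have := bnd _ _ (walk_trans wp wq).
    rewrite walk_sum_cat (walk_last wp) size_cat mulnDr /cost /d; lia.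
  have e : exists n, `[< exists2 p, walk x0 y p & n%:Z = cost p + d >].
    have [p wp] := Xconn.2 x0 y; exists (absz (cost p + d)); apply/asboolP.
    by exists p => //; rewrite gez0_abs ?pos.
  case: (ex_minnP e) => n /asboolP[p wp nE] minn; exists (n%:Z - d); split.
    by exists p => //; rewrite nE addrK.
  move=> r wr; rewrite lerBlDr -(gez0_abs (pos _ wr)) lez_nat minn //.
  by apply/asboolP; exists r => //; rewrite gez0_abs ?pos.
exists f => x y xy.
have step u v : adj u v -> f v <= f u + w u v + C%:Z.
  move=> uv; have [[p wp ->] _] := fP u; have [_ le] := fP v.
  have {}le := le (p ++ [:: v]).
  apply: le_trans (le _) _.
    by apply: walk_trans wp _; rewrite walk_cons uv walk_nil eqxx.
  rewrite /cost walk_sum_cat size_cat (walk_last wp) /= addr0; lia.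
move: (step _ _ xy) (step y x); rewrite adj_sym xy => s1 /(_ isT).
rewrite (alt y x); lia.
Qed.

Local Open Scope nat_scope.

(* The vertex farthest from the base point of a closed walk that is geodesic at
   scale [m] lies, by slimness, uniformly close to the base point. *)
Lemma shortcut : gromov_hyperbolic X -> exists m, forall x p,
  walk x x p -> 0 < size p -> exists i j,
    [/\ i <= j <= size p, j - i <= m
      & dist (nth x (x :: p) i) (nth x (x :: p) j) < j - i].
Proof.
case=> d slim; pose m := (2 * d).+1; exists (2 * m) => x p wp p0.
set c := nth x (x :: p); apply: contrapT => noshort.
have c0 : c 0 = x by [].
have cn : c (size p) = x by rewrite /c -last_nth; exact: walk_last wp.
have geo i j : i <= j <= size p -> j - i <= 2 * m -> dist (c i) (c j) = j - i.
  move=> ij jim; have [w s _] := subwalkP wp ij.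
  apply/eqP; rewrite eqn_leq -{1}s dist_le //= leqNgt; apply/negP => lt.
  by apply: noshort; exists i, j.
have [t maxt] : exists t : 'I_(size p).+1,
    forall i, i <= size p -> dist x (c i) <= dist x (c t).
  case: (arg_maxnP (fun i : 'I_(size p).+1 => dist x (c i)) (isT : predT ord0)).
  by move=> t _ maxt; exists t => i ip; apply: (maxt (Ordinal (n:=(size p).+1) (m:=i) ip)).
have tp : t <= size p by rewrite -ltnS.
(* Slimness, applied to a subwalk reaching [m] steps to either side of [c t] (clipped at the ends of
   [p]), gives [v] within [d] of [c t] on a geodesic from one end of the subwalk to [x]. If that end
   is [x], so is [v]. Otherwise the end lies at distance [m > 2 * d] from [c t], and would be
   farther from [x] than [c t]. *)
have near : dist x (c t) <= d.
  pose i := t - m; pose j := minn (size p) (t + m).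
  have ij : i <= j <= size p by rewrite /i /j; lia.
  have [w s _] := subwalkP wp ij.
  have gp : geodesic (c i) (c j) (subwalk p i j).
    apply/(geodesicE Xconn); split=> //; rewrite s geo //; rewrite /i /j; lia.
  have [q wq sq] := dist_geodesic Xconn (c j) x.
  have [r wr sr] := dist_geodesic Xconn (c i) x.
  have gq : geodesic (c j) x q by apply/(geodesicE Xconn).
  have gr : geodesic (c i) x r by apply/(geodesicE Xconn).
  have ut : c t \in c i :: subwalk p i j.
    have ip : i <= t <= size p by rewrite /i; lia.
    have jp : t <= j <= size p by rewrite /j; lia.
    have [wi si _] := subwalkP wp ip; have [wj sj _] := subwalkP wp jp.
    suff <- : subwalk p i t ++ subwalk p t j = subwalk p i j.
      by rewrite -cat_cons mem_cat -[c t](walk_last wi) mem_last.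
    rewrite /subwalk -(_ : t - i + (j - t) = j - i); last by lia.
    by rewrite takeD drop_drop subnK //; lia.
  have [v + /(within_distE Xconn) duv] := slim _ _ _ _ _ _ gp gq gr _ ut.
  have side k s' : k <= size p -> geodesic (c k) x s' -> v \in c k :: s' ->
      c k = x \/ dist (c k) (c t) = m -> dist x (c t) <= d.
    move=> kp gs vs [ckx|dk].
      move: (geodesic_mem Xconn gs vs); rewrite ckx distxx // => /eqP.
      rewrite addn_eq0 => /andP[_ /eqP/(dist_eq0 Xconn) vx].
      by rewrite (dist_sym Xconn) -vx.
    move: (geodesic_mem Xconn gs vs) (dist_trans Xconn (c t) v x) (maxt _ kp).
    move: (dist_trans Xconn (c k) v (c t)).
    rewrite (dist_sym Xconn v (c t)) (dist_sym Xconn (c t) x) (dist_sym Xconn (c k) x).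
    rewrite /m in dk; lia.
  rewrite mem_cat => /orP[vq|vr].
    apply: (side j q) => //; first by rewrite /j; lia.
    rewrite /j; case: (leqP (size p) (t + m)) => ptm; first by left.
    right; rewrite (dist_sym Xconn) geo; lia.
  apply: (side i r) => //; first by rewrite /i; lia.
  rewrite /i; case: (leqP m t) => mt.
    by right; rewrite geo; lia.
  by left; have -> : t - m = 0 by lia.
(* Either [c m] is at distance [m > d] from [x], against maximality, or the whole closed walk is a
   geodesic of positive length. *)
case: (leqP m (size p)) => mp.
  move: (maxt _ mp); rewrite -[X in dist X (c m)]c0 geo; rewrite ?subn0;
    rewrite /m in near *; lia.
have := geo 0 (size p); rewrite c0 cn distxx; lia.
Qed.

(** Replacing the subwalk found by [shortcut] with a geodesic shortens a closed walk by at least one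
    and changes its sum by that of a closed walk of length at most [2 * m], hence by at most [K]. *)
Lemma hyperbolic_linear : gromov_hyperbolic X -> exists N, forall w K,
  alternating w ->
  (forall x p, walk x x p -> size p <= N -> (`|walk_sum w x p| <= K%:Z)%R) ->
  linear_bound w K.
Proof.
move=> /shortcut[m short]; exists (2 * m) => w K alt bnd x p.
have [n] := ubnP (size p); elim: n x p => // n IH x p sp wp.
have [p0|p0] := posnP (size p).
  by rewrite (size0nil p0) muln0.
have [i [j [ij jim lt]]] := short _ _ wp p0.
have [ws ss pE] := subwalkP wp ij.
set s := subwalk p i j in ws ss pE.
set a := nth x _ i in ws lt; set b := nth x _ j in ws lt.
have [t wt st] := dist_geodesic Xconn a b.
have [t' [wt' st' et']] := walk_sum_rev alt wt.
have [pj pi] : j <= size p /\ i <= size p by lia.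
have wi : walk x a (take i p).
  by have := wp; rewrite -{1}(cat_take_drop i p) walk_cat last_take // => /andP[].
have wj : walk b x (drop j p).
  by have := wp; rewrite -{1}(cat_take_drop j p) walk_cat last_take // => /andP[].
have eS : walk_sum w x p =
    (walk_sum w x (take i p) + (walk_sum w a s + walk_sum w b (drop j p)))%R.
  by rewrite {1}pE !walk_sum_cat (walk_last wi) (walk_last ws).
have szi : size (take i p) = i by rewrite size_takel.
have szj : size (drop j p) = size p - j by rewrite size_drop.
have := bnd _ _ (walk_trans ws wt').
rewrite walk_sum_cat (walk_last ws) et' size_cat ss st' st.
have -> : j - i + dist a b <= 2 * m by lia.
move=> /(_ isT) bnd2.
have := IH _ _ _ (walk_trans wi (walk_trans wt wj)).
rewrite !walk_sum_cat (walk_last wi) (walk_last wt) !size_cat szi szj st.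
have -> : i + (dist a b + (size p - j)) < n by lia.
move=> /(_ isT) bnd1.
have : K * (i + (dist a b + (size p - j))) + K <= K * size p.
  by rewrite -mulnSr leq_mul2l; lia.
rewrite eS; lia.
Qed.

End Cochains.

(** * Reduction of closed walks to circuits *)

Lemma not_uniq_split (T : eqType) (p : seq T) : ~~ uniq p ->
  exists v p1 p2 p3, p = p1 ++ v :: p2 ++ v :: p3.
Proof.
elim: p => //= v p IH; rewrite negb_and negbK => /orP[|/IH].
  by case/splitPr => p1 p2; exists v, [::], p1, p2.
by case=> [w [p1 [p2 [p3 ->]]]]; exists w, (v :: p1), p2, p3.
Qed.

Section Circuits.
Context (X : graph).
Implicit Types (x y : X) (p : seq X) (w : X -> X -> int).

(** As [p] omits the starting point and ends at it, [uniq p] forbids every repetition but the return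
    to [x]. An edge run forth and back is a circuit. *)
Definition circuit x p := [&& walk x x p, uniq p & p != [::]].

(** A repeated vertex splits a closed walk into two shorter ones, whose sums and lengths add up. *)
Lemma circuit_bound w (K N : nat) :
  (forall x p, circuit x p -> size p <= N -> (`|walk_sum w x p| <= K%:Z)%R) ->
  forall x p, walk x x p -> size p <= N ->
    (`|walk_sum w x p| <= (K * size p)%N%:Z)%R.
Proof.
move=> bnd x p; have [n] := ubnP (size p); elim: n x p => // n IH x p sp wp spN.
have [->|p0] := eqVneq p [::]; first by rewrite muln0.
have [up|/not_uniq_split[v [p1 [p2 [p3 pE]]]]] := boolP (uniq p).
  have := bnd x p; rewrite /circuit wp up p0 => /(_ isT spN).
  have : K <= K * size p by rewrite leq_pmulr // lt0n size_eq0.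
  lia.
move: wp sp spN; rewrite pE -cat_rcons -cat_rcons catA walk_cat.
rewrite last_cat walk_cat !last_rcons => /andP[/andP[w1 w2] w3].
rewrite !size_cat !size_rcons => sp spN.
have := IH _ _ _ (walk_trans w1 w3); have := IH _ _ _ w2.
rewrite size_cat !size_rcons !walk_sum_cat last_cat !last_rcons.
move=> i1 i2.
have {}i1 := i1 ltac:(lia) ltac:(lia).
have {}i2 := i2 ltac:(lia) ltac:(lia).
rewrite !mulnDr in i1 i2 *; lia.
Qed.

Lemma hyperbolic_potential : connected_graph X -> gromov_hyperbolic X ->
  exists N : nat, forall w K, alternating w ->
  (forall x p, circuit x p -> size p <= N -> (`|walk_sum w x p| <= K%:Z)%R) ->
  exists f : X -> int, forall x y, adj x y ->
    (`|w x y - (f y - f x)| <= (K * N)%N%:Z)%R.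
Proof.
move=> Xc /(hyperbolic_linear Xc)[N lin]; exists N => w K alt bnd.
apply: potential => //; apply: lin => // x p wp sp.
have := circuit_bound bnd wp sp.
by have : K * size p <= K * N by [rewrite leq_mul2l sp orbT]; lia.
Qed.

End Circuits.

Lemma last_true (P : nat -> Prop) n : P 0 ->
  exists k, [/\ k <= n, P k & forall i, k < i <= n -> ~ P i].
Proof.
move=> P0; elim: n => [|n [k [kn Pk maxk]]].
  by exists 0; split=> // i; lia.
have [Pn|nPn] := pselect (P n.+1); first by exists n.+1; split=> // i; lia.
exists k; split=> // [|i ki]; first exact: leqW.
by have [->//|ni] := eqVneq i n.+1; apply: maxk; lia.
Qed.

(** * The isoperimetric inequality implies slim triangles *)

Section Isoperimetry.
Context (X : graph).
Implicit Types (x y u v : X) (p : seq X) (f g : X -> int).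
Local Open Scope ring_scope.

Definition lipschitz f := forall x y, adj x y -> `|f x - f y| <= 1.

(** The discrete [f dg - g df]: over a closed walk it sums to twice the signed area enclosed by the
    image under [(f, g)] in the plane. *)
Definition area_form f g x y : int := f x * g y - f y * g x.

Definition area_linear (C : nat) := forall f g,
  lipschitz f -> lipschitz g -> linear_bound (area_form f g) C.

Lemma area_const_l f g (c : int) x p : {in x :: p, forall u, f u = c} ->
  walk_sum (area_form f g) x p = c * (g (last x p) - g x).
Proof.
elim: p x => [|y p IH] x fc /=; first by rewrite subrr mulr0.
rewrite IH; last by move=> u up; apply: fc; rewrite inE up orbT.
by rewrite /area_form !fc ?inE ?eqxx ?orbT //; lia.
Qed.

Lemma area_const_r f g (c : int) x p : {in x :: p, forall u, g u = c} ->
  walk_sum (area_form f g) x p = c * (f x - f (last x p)).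
Proof.
elim: p x => [|y p IH] x gc /=; first by rewrite subrr mulr0.
rewrite IH; last by move=> u up; apply: gc; rewrite inE up orbT.
by rewrite /area_form !gc ?inE ?eqxx ?orbT //; lia.
Qed.

Hypothesis Xconn : connected_graph X.
Local Open Scope nat_scope.

(** The cap makes the distance to [s] constant on everything at distance at least [D] from [s], such
    as the far side of a rectangle. *)
Definition capped_dist D (s : seq X) u := foldr (fun v => minn (dist u v)) D s.

Lemma capped_dist_lip D s u v : adj u v ->
  capped_dist D s u <= (capped_dist D s v).+1.
Proof.
move=> uv; elim: s => /= [|a s IH]; first by [].
have := dist_trans Xconn u v a; have := dist_adj uv; lia.
Qed.

Lemma capped_dist0 D s u : u \in s -> capped_dist D s u = 0.
Proof.
elim: s => //= a s IH; rewrite inE => /orP[/eqP <-|/IH ->].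
  by rewrite distxx min0n.
by rewrite minn0.
Qed.

Lemma capped_dist_far D s u : {in s, forall v, D <= dist u v} ->
  capped_dist D s u = D.
Proof.
elim: s => //= a s IH far; rewrite IH; first by apply/minn_idPr/far/mem_head.
by move=> v vs; apply: far; rewrite inE vs orbT.
Qed.

(* A Besicovitch inequality: the area form of the two (truncated) distance
   functions integrates to twice the product of the distances between the two
   pairs of opposite sides of a rectangle. *)
Lemma rectangle C D D1 a b a' b' p e : area_linear C ->
  geodesic a b p -> walk b' a' e ->
  dist a a' <= D1 -> dist b b' <= D1 ->
  {in a :: p & b' :: e, forall u v, D <= dist v u} ->
  2 * D * (size p - 2 * D1) <= C * (size p + 2 * D1 + size e).
Proof.
move=> area gp we da db far.
have /(geodesicE Xconn)[wp sp] := gp.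
have [h1 w1 s1] := dist_geodesic Xconn a' a.
have [h2 w2 s2] := dist_geodesic Xconn b b'.
(* Around the rectangle, [f] is 0 on [p] and [D] on [e], while [g], whose cut-offs absorb the
   lengths of the short sides, is 0 on [h1] and [M] on [h2]. Only [h2] and [e] contribute, each
   [- D * M]. *)
pose f u := Posz (capped_dist D (a :: p) u).
pose M := size p - 2 * D1.
pose g u := Posz (minn (dist a u - D1) M).
have lf : lipschitz f.
  move=> x y xy; have := capped_dist_lip D (a :: p) xy.
  by have := @capped_dist_lip D (a :: p) y x; rewrite adj_sym xy /f; lia.
have lg : lipschitz g.
  move=> x y xy; have := dist_trans Xconn a x y; have := dist_trans Xconn a y x.
  rewrite (dist_sym Xconn y x); have := dist_adj xy; rewrite /g; lia.
have wl := walk_trans wp (walk_trans w2 (walk_trans we w1)).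
have := area _ _ lf lg _ _ wl.
rewrite !walk_sum_cat (walk_last wp) (walk_last w2) (walk_last we) !size_cat s1 s2.
have inh1 u : u \in a' :: h1 -> g u = 0.
  move=> /(walk_mem_dist w1); have := dist_sym Xconn a u.
  by have := dist_sym Xconn a' a; rewrite /g s1; lia.
have inh2 u : u \in b :: h2 -> g u = M.
  move=> /(walk_mem_dist w2); have := dist_trans Xconn a u b; have := dist_sym Xconn b u.
  by rewrite /g /M s2 sp; lia.
have ine u : u \in b' :: e -> f u = D.
  by move=> ue; rewrite /f capped_dist_far // => v vp; apply: far.
have inp u : u \in a :: p -> f u = 0.
  by move=> up; rewrite /f capped_dist0.
have mem_b : b \in a :: p by rewrite -(walk_last wp) mem_last.
have mem_a' : a' \in b' :: e by rewrite -(walk_last we) mem_last.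
rewrite (area_const_l _ inp) (area_const_r _ inh2) (area_const_l _ ine).
rewrite (area_const_r _ inh1) (walk_last w2) (walk_last we) (inp _ mem_b).
rewrite (ine b') ?mem_head // (inh1 a') ?mem_head // (inh2 b'); last first.
  by rewrite -[X in X \in _](walk_last w2) mem_last.
rewrite -/M; set L := size p + _; have -> : L = size p + dist b b' + size e + dist a' a.
  by rewrite /L; lia.
rewrite (dist_sym Xconn a' a) => bound.
have : C * (size p + dist b b' + size e + dist a a') <= C * (size p + 2 * D1 + size e).
  by rewrite leq_mul2l; lia.
nia.
Qed.

Lemma geodesic_sub s t S u v : geodesic s t S -> u \in s :: S -> v \in s :: S ->
  exists E, [/\ walk u v E, size E = dist u v & {subset u :: E <= s :: S}].
Proof.
move=> gS; have /(geodesicE Xconn)[wS _] := gS.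
wlog uv : u v / index u (s :: S) <= index v (s :: S).
  move=> wl us vs; case: (leqP (index u (s :: S)) (index v (s :: S))) => [le|/ltnW le].
    exact: wl.
  have [E [wE sE subE]] := wl v u le vs us.
  have [F [wF sF memF]] := walk_rev wE.
  exists F; rewrite sF sE (dist_sym Xconn); split=> // a.
  by rewrite memF; exact: subE.
move=> us vs; have ui := nth_index s us; have vi := nth_index s vs.
have vS : index v (s :: S) <= size S.
  by rewrite -ltnS -[X in _ < X]/(size (s :: S)) index_mem.
set i := index u _ in ui uv; set j := index v _ in vi uv vS.
have ij : i <= j <= size S by rewrite uv vS.
have [w sz E] := subwalkP wS ij.
exists (subwalk S i j); rewrite -[in walk _ _](ui) -[in walk _ _](vi) sz.
rewrite -[in dist _ _]ui -[in dist _ _]vi (geodesic_nth Xconn gS ij); split=> //.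
move=> a; rewrite inE => /orP[/eqP ->//|aE].
by rewrite E in_cons !mem_cat aE !orbT.
Qed.

Section Slim.
Variable C : nat.
Hypothesis area : area_linear C.
Let D := 2 * C + 1.

(* Taking [D] larger than the isoperimetric constant makes the area term
   [2 * D * size p] absorb the perimeter term. *)
Lemma long_side D1 k a b a' b' p e :
  geodesic a b p -> walk b' a' e ->
  dist a a' <= D1 -> dist b b' <= D1 -> size e <= 2 * size p + k ->
  {in a :: p & b' :: e, forall u v, D <= dist v u} ->
  size p <= 4 * D * D1 + C * (2 * D1 + k).
Proof.
move=> gp we da db se far; have := rectangle area gp we da db far.
rewrite /D; nia.
Qed.

(** The walks [B] and [E], with a geodesic joining them, form one side opposite to [A]. The joining
    geodesic has length at most [2 * D], so each of its points is within [D] of one of its ends and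
    stays [D]-far from [A]. *)
Lemma hexagon a0 a1 b0 b1 c0 c1 A B E :
  geodesic a0 a1 A -> walk b0 b1 B -> walk c0 c1 E ->
  dist a1 b0 <= 2 * D -> dist b1 c0 <= 2 * D -> dist c1 a0 <= 2 * D ->
  size B <= size A -> size E <= size A ->
  {in a0 :: A & b0 :: B, forall u v, 2 * D <= dist u v} ->
  {in a0 :: A & c0 :: E, forall u v, 2 * D <= dist u v} ->
  size A <= 4 * D * (2 * D) + C * (2 * (2 * D) + 2 * D).
Proof.
move=> gA wB wE ab bc ca sB sE farB farE.
have [h wh sh] := dist_geodesic Xconn b1 c0.
apply: (@long_side (2 * D) (2 * D) a0 a1 c1 b0 A (B ++ h ++ E)) => //.
- exact: walk_trans wB (walk_trans wh wE).
- by rewrite (dist_sym Xconn).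
- by rewrite !size_cat sh; lia.
move=> u v uA; rewrite (dist_sym Xconn v u) inE !mem_cat.
have D2 : D <= 2 * D by lia.
rewrite orbA -in_cons => /orP[vB|/orP[vh|vE]].
- exact: leq_trans (farB _ _ uA vB).
- have := @walk_mem_dist _ _ _ _ v wh; rewrite inE vh orbT sh => /(_ isT).
  have b1B : b1 \in b0 :: B by rewrite -(walk_last wB) mem_last.
  have := farB _ _ uA b1B; have := farE _ _ uA (mem_head _ _).
  have := dist_trans Xconn u v b1; have := dist_trans Xconn u v c0.
  rewrite (dist_sym Xconn v b1); lia.
- by apply: leq_trans (farE _ _ uA _) => //; rewrite inE vE orbT.
Qed.

(** Dominates both the bound of [long_side] with [D1 = 4 * D] and [k = 2 * D1], and the bound of
    [hexagon]. *)
Let M := 4 * D * (4 * D) + C * (2 * (4 * D) + 2 * (4 * D)).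

(** The part of [S] between [v2] and [v1] completes [A] to a quadrilateral, and by the triangle
    inequality it exceeds [A] by at most [2 * D1]. *)
Lemma same_side D1 a b A s t S v1 v2 : D1 <= 4 * D ->
  geodesic a b A -> geodesic s t S -> v1 \in s :: S -> v2 \in s :: S ->
  dist a v1 <= D1 -> dist b v2 <= D1 ->
  {in a :: A & s :: S, forall u v, D <= dist u v} -> size A <= M.
Proof.
move=> leD1 gA gS v1S v2S av bv far.
have [E [wE sE subE]] := geodesic_sub gS v2S v1S.
have /(geodesicE Xconn)[wA sA] := gA.
suff : size A <= 4 * D * D1 + C * (2 * D1 + 2 * D1) by rewrite /M; nia.
apply: (long_side gA wE) => //.
  have := dist_trans Xconn v2 b v1; have := dist_trans Xconn b a v1.
  rewrite (dist_sym Xconn v2 b) (dist_sym Xconn b a); lia.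
by move=> u v uA vE; rewrite (dist_sym Xconn v u); apply: far (subE _ vE).
Qed.

(** The corner at [z] is cut off where [S] last comes near [T]. If that happens at [v1], both ends
    of [A] are near [T]; otherwise a hexagon remains, with long sides on [A], [S] and [T]. *)
Lemma two_sides a b A z s t S T v1 v2 :
  geodesic a b A -> geodesic z s S -> geodesic z t T ->
  v1 \in z :: S -> v2 \in z :: T ->
  dist a v1 <= 2 * D -> dist b v2 <= 2 * D ->
  {in a :: A & z :: S, forall u v, 2 * D <= dist u v} ->
  {in a :: A & z :: T, forall u v, 2 * D <= dist u v} -> size A <= M.
Proof.
move=> gA gS gT v1S v2T av bv farS farT.
have D2 : D <= 2 * D by lia.
have [wS _] := (geodesicE Xconn _ _ _).1 gS.
pose c := nth z (z :: S).
pose near i := exists2 v, v \in z :: T & dist (c i) v <= 2 * D.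
have near0 : near 0 by exists z; rewrite ?mem_head // /c /= distxx.
have i1S : index v1 (z :: S) <= size S.
  by rewrite -ltnS -[X in _ < X]/(size (z :: S)) index_mem.
have cv1 : c (index v1 (z :: S)) = v1 by exact: nth_index.
move: (index _ _) i1S cv1 => l lS cv1.
have [k [ki [r' r'T kr'] maxk]] := last_true l near0.
move: ki; rewrite leq_eqVlt => /orP[/eqP kE|ki].
  apply: (@same_side (4 * D) _ _ _ _ _ _ r' v2 _ gA gT) => //.
  - have := dist_trans Xconn a v1 r'; rewrite -{2}cv1 -kE; lia.
  - by move: bv; lia.
  - by move=> u v uA vT; apply: leq_trans (farT _ _ uA vT).
have kij : k <= l <= size S by rewrite ltnW.
have [wB sB SE] := subwalkP wS kij.
set B := subwalk _ _ _ in wB sB SE.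
rewrite -[nth _ _ k]/(c k) -[nth _ _ _]/(c _) cv1 in wB.
have gB : geodesic (c k) v1 B.
  by apply/(geodesicE Xconn); split=> //; rewrite sB -cv1 (geodesic_nth Xconn gS kij).
have subB u : u \in c k :: B -> u \in z :: S.
  by move=> /(subwalk_mem kij)[i /andP[_ il] ->]; rewrite mem_nth // ltnS (leq_trans il).
have farB : {in c k :: B & z :: T, forall u v, 2 * D <= dist u v}.
  move=> u v /(subwalk_mem kij)[i /andP[ki' il] ->] vT; rewrite -/(c i).
  (* The vertex [c k] is itself near [T], but its successor is at distance more than [2 * D], which
     leaves at least [2 * D] for [c k]. *)
  have [kE|ki2] := eqVneq k i; last first.
    rewrite leqNgt; apply/negP => lt; apply: (maxk i); first by lia.
    by exists v => //; exact: ltnW lt.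
  have iS : i < size S by lia.
  have := dist_adj (nth_walk_adj wS iS); have := dist_trans Xconn (c i.+1) (c i) v.
  rewrite (dist_sym Xconn (c i.+1) (c i)) -/(c i) -/(c i.+1) => tr ad.
  suff : 2 * D < dist (c i.+1) v by lia.
  rewrite ltnNge; apply/negP => le; apply: (maxk i.+1); first by lia.
  by exists v.
have [E [wE sE subE]] := geodesic_sub gT r'T v2T.
have gE : geodesic r' v2 E by apply/(geodesicE Xconn).
have sym := dist_sym Xconn.
have [E' [wE' sE' memE']] := walk_rev wE.
have gE' : geodesic v2 r' E' by apply/(geodesicE Xconn); rewrite sE' sE sym.
have farAB : {in a :: A & c k :: B, forall u v, 2 * D <= dist u v}.
  by move=> u v uA /subB; apply: farS.
have farAE : {in a :: A & v2 :: E', forall u v, 2 * D <= dist u v}.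
  by move=> u v uA; rewrite memE' => /subE; apply: farT.
have farBE : {in c k :: B & v2 :: E', forall u v, 2 * D <= dist u v}.
  by move=> u v uB; rewrite memE' => /subE; apply: farB.
have far_sym (p q : seq X) : {in p & q, forall u v, 2 * D <= dist u v} ->
    {in q & p, forall u v, 2 * D <= dist u v}.
  by move=> far u v up vq; rewrite sym; apply: far.
have leM n : n <= 4 * D * (2 * D) + C * (2 * (2 * D) + 2 * D) -> n <= M.
  by rewrite /M; nia.
have v1a : dist v1 a <= 2 * D by rewrite sym.
have r'k : dist r' (c k) <= 2 * D by rewrite sym.
have v2b : dist v2 b <= 2 * D by rewrite sym.
(* [hexagon] bounds the longest of the three long sides, whichever it is. *)
apply: leM.
have hA : size B <= size A -> size E' <= size A -> _ :=
  fun lB lE => hexagon gA wE' wB bv r'k v1a lE lB farAE farAB.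
have hE : size B <= size E' -> size A <= size E' -> _ :=
  fun lB lA => hexagon gE' wB gA.1 r'k v1a bv lB lA
    (far_sym _ _ farBE) (far_sym _ _ farAE).
have hB : size A <= size B -> size E' <= size B -> _ :=
  fun lA lE => hexagon gB gA.1 wE' v1a bv r'k lA lE (far_sym _ _ farAB) farBE.
by lia.
Qed.

(** Around [u], take the longest stretch of [p] whose interior stays away from the other two sides.
    Its ends are near those sides, so it suffices to bound its length, according to which sides the
    ends approach. *)
Lemma area_linear_slim : gromov_hyperbolic X.
Proof.
exists (M + 2 * D) => x y z p q r gp gq gr u up.
have D2 : D <= 2 * D by lia.
have [wp sp] := (geodesicE Xconn _ _ _).1 gp.
have [wq sq] := (geodesicE Xconn _ _ _).1 gq.
have [wr sr] := (geodesicE Xconn _ _ _).1 gr.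
pose c := nth x (x :: p); pose S := (y :: q) ++ (x :: r).
pose near i := exists2 v, v \in S & dist (c i) v <= 2 * D.
have near0 : near 0.
  by exists x; rewrite ?mem_cat ?mem_head ?orbT // /c /= distxx.
have nearp : near (size p - 0).
  exists y; rewrite ?mem_cat ?mem_head // /c subn0 -last_nth (walk_last wp).
  by rewrite distxx.
have := nth_index x up; have : index u (x :: p) <= size p.
  by rewrite -ltnS -[X in _ < X]/(size (x :: p)) index_mem.
set m := index u _ => mp; rewrite -/(c m) => cm.
have [i [im [v1 v1S cv1] maxi]] := last_true m near0.
(* On reversed indices, [last_true] yields the first near vertex from [m] on. *)
have [j' [jm [v2 v2S cv2] maxj]] := last_true (P := fun i => near (size p - i))
  (size p - m) nearp.
pose j := size p - j'; rewrite -/j in cv2.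
have ij : i <= j <= size p by rewrite /j; lia.
have [wA sA pE] := subwalkP wp ij.
set A := subwalk _ _ _ in wA sA pE.
have gA : geodesic (c i) (c j) A.
  by apply/(geodesicE Xconn); rewrite (geodesic_nth Xconn gp ij).
have far_in k : i < k < j -> ~ near k.
  move=> ikj; have [km|mk] := leqP k m; first by apply: maxi; lia.
  have kp : k <= size p by lia.
  by have := maxj (size p - k); rewrite /= subKn //; apply; move: ikj; rewrite /j; lia.
suff AM : size A <= M.
  exists v1 => //; apply/(within_distE Xconn).
  have mi : i <= m <= size p by lia.
  have := dist_trans Xconn u (c i) v1.
  rewrite -cm (dist_sym Xconn (c m) (c i)) (geodesic_nth Xconn gp mi); lia.
(* A stretch without interior vertices offers no far neighbour from which to estimate distances at
   its ends. *)
have [ij1|ij1] := leqP (j - i) 1.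
  by rewrite sA (leq_trans ij1) // /M /D; nia.
have far : {in c i :: A & S, forall u v, 2 * D <= dist u v}.
  move=> a v /(subwalk_mem ij)[k ikj ->] vS; rewrite -/(c k).
  have far_k l : i < l < j -> 2 * D < dist (c l) v.
    by move=> /far_in fl; rewrite ltnNge; apply/negP => le; apply: fl; exists v.
  have [->|ki] := eqVneq k i.
    have := far_k i.+1 ltac:(lia); have ip : i < size p by lia.
    have := dist_adj (nth_walk_adj wp ip); have := dist_trans Xconn (c i.+1) (c i) v.
    rewrite (dist_sym Xconn (c i.+1) (c i)) -/(c i) -/(c i.+1); lia.
  have [->|kj] := eqVneq k j; last by apply/ltnW/far_k; lia.
  have := far_k j.-1 ltac:(lia); have jp : j.-1 < size p by lia.
  have := dist_adj (nth_walk_adj wp jp); have := dist_trans Xconn (c j.-1) (c j) v.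
  rewrite -/(c j.-1) (_ : j.-1.+1 = j) -/(c j); [lia|lia].
have [q' [wq' sq' memq']] := walk_rev wq.
have [r' [wr' sr' memr']] := walk_rev wr.
have gq' : geodesic z y q' by apply/(geodesicE Xconn); rewrite sq' sq (dist_sym Xconn).
have gr' : geodesic z x r' by apply/(geodesicE Xconn); rewrite sr' sr (dist_sym Xconn).
have farq : {in c i :: A & z :: q', forall u v, 2 * D <= dist u v}.
  by move=> a v aA; rewrite memq' => vq; apply: far; rewrite // mem_cat vq.
have farr : {in c i :: A & z :: r', forall u v, 2 * D <= dist u v}.
  by move=> a v aA; rewrite memr' => vr; apply: far; rewrite // mem_cat vr orbT.
have weak (s : seq X) : {in c i :: A & s, forall u v, 2 * D <= dist u v} ->
    {in c i :: A & s, forall u v, D <= dist u v}.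
  by move=> h a v aA vs; apply: leq_trans (h _ _ aA vs).
have D4 : 2 * D <= 4 * D by lia.
move: v1S v2S; rewrite !mem_cat -!memq' -!memr' => /orP[v1S|v1S] /orP[v2S|v2S].
- exact: same_side D4 gA gq' v1S v2S cv1 cv2 (weak _ farq).
- exact: two_sides gA gq' gr' v1S v2S cv1 cv2 farq farr.
- exact: two_sides gA gr' gq' v1S v2S cv1 cv2 farr farq.
- exact: same_side D4 gA gr' v1S v2S cv1 cv2 (weak _ farr).
Qed.
End Slim.
End Isoperimetry.

Lemma geodesic_uniq (X : graph) (x y : X) p : connected_graph X ->
  geodesic x y p -> uniq (x :: p).
Proof.
move=> Xc gp; apply/negPn/(uniqPn x) => -[i [j [ij jp e]]].
have ijp : i <= j <= size p by rewrite (ltnW ij).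
by have := geodesic_nth Xc gp ijp; rewrite e distxx; lia.
Qed.

(** * Relatively compact sets and stabilizers *)

Section Bounded.
Context (G : topologicalGroupType).
Implicit Types (A B U : set G) (g h : G).

Lemma mulgl_continuous h : continuous (fun g : G => h * g).
Proof.
move=> g; apply: (@continuous_comp _ _ _ (fun g : G => (h, g))
  (fun p : G * G => p.1 * p.2)); last exact: mulg_continuous.
by apply: cvg_pair => /=; [exact: cvg_cst | exact: cvg_id].
Qed.

Lemma mulgr_continuous h : continuous (fun g : G => g * h).
Proof.
move=> g; apply: (@continuous_comp _ _ _ (fun g : G => (g, h))
  (fun p : G * G => p.1 * p.2)); last exact: mulg_continuous.
by apply: cvg_pair => /=; [exact: cvg_id | exact: cvg_cst].
Qed.

Definition bounded A := exists2 K : set G, compact K & A `<=` K.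

Lemma bounded_sub A B : A `<=` B -> bounded B -> bounded A.
Proof. by move=> AB [K cK BK]; exists K => //; apply: subset_trans BK. Qed.

Lemma compact_bounded A : compact A -> bounded A.
Proof. by exists A. Qed.

Lemma bounded1 g : bounded [set g].
Proof. exact/compact_bounded/compact_set1. Qed.

Lemma boundedU A B : bounded A -> bounded B -> bounded (A `|` B).
Proof.
move=> [K cK AK] [L cL BL]; exists (K `|` L); first exact: compactU.
exact: setUSS.
Qed.

Lemma boundedM A B : bounded A -> bounded B ->
  bounded [set x * y | x in A & y in B].
Proof.
move=> [K cK AK] [L cL BL].
exists ((fun p : G * G => p.1 * p.2) @` (K `*` L)).
  apply: continuous_compact; last exact: compact_setX.
  exact/continuous_subspaceT/mulg_continuous.
by move=> _ [x Ax [y By <-]]; exists (x, y) => //; split; [exact: AK|exact: BL].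
Qed.

Lemma boundedV A : bounded A -> bounded [set x^-1 | x in A].
Proof.
move=> [K cK AK]; exists ((fun x => x^-1) @` K); last exact: image_subset.
by apply: continuous_compact => //; exact/continuous_subspaceT/invg_continuous.
Qed.

Lemma bounded_seq (T : eqType) (l : seq T) (F : T -> set G) :
  (forall t, t \in l -> bounded (F t)) ->
  bounded [set g | exists2 t, t \in l & F t g].
Proof.
elim: l => [|t l IH] bF.
  by exists set0; [exact: compact0 | move=> g []].
apply: (@bounded_sub _ (F t `|` [set g | exists2 t, t \in l & F t g])).
  move=> g [s]; rewrite inE => /orP[/eqP ->|sl] Fg; first by left.
  by right; exists s.
apply: boundedU; first exact/bF/mem_head.
by apply: IH => s sl; apply: bF; rewrite inE sl orbT.
Qed.

Lemma bounded_translate A B g : bounded A ->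
  (forall x, B x -> A (g * x)) -> bounded B.
Proof.
move=> bA sub; apply: bounded_sub (boundedM (bounded1 g^-1) bA) => x /sub Ax.
by exists g^-1 => //; exists (g * x) => //; rewrite mulKg.
Qed.

Lemma open_translate U h : open U -> open [set g | U (h^-1 * g)].
Proof.
move=> oU; apply: (@open_comp _ _ (fun g => h^-1 * g)) => // g _.
exact: mulgl_continuous.
Qed.

Lemma bounded_cosets A U : bounded A -> open U -> U 1 ->
  exists l : seq G, forall g, A g -> exists2 h, h \in l & U (h^-1 * g).
Proof.
move=> [K cK AK] oU U1.
(* The cover form of compactness is used for pointed spaces, so [G] is pointed at 1. *)
pose T : ptopologicalType := HB.pack_for ptopologicalType (G : Type)
  (TopologicalGroup.class G) (isPointed.Build G 1).
have {}cK : cover_compact K by have : @compact T K := cK; rewrite compact_cover.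
have [||D _ KD] := cK _ [set: G] (fun h => [set g | U (h^-1 * g)]).
- by move=> h _; exact: open_translate.
- by move=> g _; exists g => //=; rewrite mulVg.
exists (enum_fset D) => g /AK /KD[h hD Ug]; exists h => //.
Qed.

Lemma open_subgroup_closed U : is_subgroup U -> open U -> closed U.
Proof.
move=> [U1 UM UV] oU; rewrite -[U]setCK; apply: open_closedC.
rewrite (_ : ~` U = \bigcup_(h in ~` U) [set g | U (h^-1 * g)]).
  by apply: bigcup_open => h _; exact: open_translate.
apply/seteqP; split=> [g nUg|g [h nUh /= Ug]]; first by exists g => //=; rewrite mulVg.
by move=> Ug'; apply: nUh; have := UM _ _ Ug' (UV _ Ug); rewrite invgM invgK mulVKg.
Qed.

Lemma closed_bounded_compact A : closed A -> bounded A -> compact A.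
Proof. by move=> clA [K cK AK]; exact: subclosed_compact clA cK AK. Qed.

Lemma conj_bounded A g : bounded A -> bounded (conj_set g A).
Proof.
move=> bA.
apply: bounded_sub (boundedM (boundedM (bounded1 g) bA) (bounded1 g^-1)).
move=> _ [x Ax <-]; exists (g * x); last by exists g^-1.
by exists g => //; exists x.
Qed.

Lemma conj_compact A g : compact A -> compact (conj_set g A).
Proof.
move=> cA; apply: (@continuous_compact _ _ (fun x => g * x * g^-1)) => //.
apply: continuous_subspaceT => x.
apply: (@continuous_comp _ _ _ (fun x : G => g * x) (fun x => x * g^-1)).
  exact: mulgl_continuous.
exact: mulgr_continuous.
Qed.

Lemma conj_open U g : open U -> open (conj_set g U).
Proof.
move=> oU; rewrite (_ : conj_set g U = [set h | U (g^-1 * h * g)]).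
  apply: (@open_comp _ _ (fun h => g^-1 * h * g)) => // h _.
  apply: (@continuous_comp _ _ _ (fun h : G => g^-1 * h) (fun h => h * g)).
    exact: mulgl_continuous.
  exact: mulgr_continuous.
apply/seteqP; split=> [_ [x Ux <-]|h Uh /=].
  by rewrite /= -!mulgA mulVg mulg1 mulKg.
by exists (g^-1 * h * g) => //; rewrite -!mulgA mulgV mulg1 mulVKg.
Qed.

End Bounded.

Section Action.
Context (G : topologicalGroupType) (X : graph) (act : G -> X -> X).
Hypothesis actP : graph_action act.
Implicit Types (x y v w : X) (p q : seq X) (g h : G).

Lemma act1 x : act 1 x = x. Proof. by have [-> _ _] := actP. Qed.

Lemma actM g h x : act (g * h) x = act g (act h x).
Proof. by have [_ -> _] := actP. Qed.

Lemma act_adj g x y : adj (act g x) (act g y) = adj x y.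
Proof. by have [_ _ ->] := actP. Qed.

Lemma actK g : cancel (act g) (act g^-1).
Proof. by move=> x; rewrite -actM mulVg act1. Qed.

Lemma actVK g : cancel (act g^-1) (act g).
Proof. by move=> x; rewrite -actM mulgV act1. Qed.

Lemma act_inj g : injective (act g). Proof. exact: can_inj (actK g). Qed.

Lemma act_walk g x y p : walk (act g x) (act g y) (map (act g) p) = walk x y p.
Proof.
elim: p x => [|v p IH] x; first by rewrite !walk_nil (inj_eq (@act_inj g)).
by rewrite /= !walk_cons act_adj IH.
Qed.

Lemma vertex_stab_subgroup x : is_subgroup (vertex_stab act x).
Proof.
split; first exact: act1.
- by move=> g h /= gx hx; rewrite /vertex_stab /= actM hx gx.
- by move=> g /= gx; rewrite /vertex_stab /= -{1}gx actK.
Qed.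

Lemma vertex_stab_act g x :
  vertex_stab act (act g x) = conj_set g (vertex_stab act x).
Proof.
apply/seteqP; split=> [h /= hx|_ [h /= hx <-]].
  exists (g^-1 * h * g); last by rewrite !mulgA mulgV mul1g mulgK.
  by rewrite /vertex_stab /= !actM hx actK.
by rewrite /vertex_stab /= !actM actK hx.
Qed.

Lemma orbit_finite (A : set G) x : open (vertex_stab act x) -> bounded A ->
  exists l : seq X, forall g, A g -> act g x \in l.
Proof.
move=> ox bA; have [l lP] := bounded_cosets bA ox (act1 x).
exists [seq act h x | h <- l] => g /lP[h hl hg]; apply/mapP; exists h => //.
by have := congr1 (act h) hg; rewrite actM actVK.
Qed.

Lemma orbit_map_bounded x y : bounded (vertex_stab act x) ->
  bounded [set g | act g x = y].
Proof.
move=> bx; have [[h hy]|none] := pselect (exists h, act h x = y); last first.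
  by exists set0; [exact: compact0 | move=> g gy; apply: none; exists g].
apply: (bounded_translate (g := h^-1) bx) => g gy.
by rewrite /vertex_stab /= actM gy -hy actK.
Qed.

End Action.

Section RelativeStabilizers.
Context (G : topologicalGroupType) (X : graph) (act : G -> X -> X).
Context (HH : set (subgroup G)).
Hypothesis rca : rel_cayley_abels act HH.
Implicit Types (x y v w : X).

Let actP := rca_action rca.

(** A nonempty such set lies in a single coset of the compact edge stabilizer. *)
Lemma transporter_bounded x y v w : adj x y ->
  bounded [set g | act g x = v /\ act g y = w].
Proof.
move=> xy; have [[h [hx hy]]|none] :=
    pselect (exists h, act h x = v /\ act h y = w); last first.
  by exists set0; [exact: compact0 | move=> g ?; apply: none; exists g].
apply: (@bounded_translate _ (edge_stab act x y) _ h^-1).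
  exact/compact_bounded/(rca_edge_stab rca).
by move=> g [gx gy]; rewrite /edge_stab /= !(actM actP) gx gy -hx -hy !(actK actP).
Qed.

Lemma vertex_stab_closed x : closed (vertex_stab act x).
Proof.
apply: open_subgroup_closed; first exact: vertex_stab_subgroup.
exact: (rca_discrete rca).1.
Qed.

(** An element fixing [x] and [y] permutes the geodesics between them, which by fineness are
    finitely many. It therefore sends the first edge of a given geodesic to one of finitely many
    edges. *)
Lemma stab_pair_bounded x y : fine X -> x <> y ->
  bounded (vertex_stab act x `&` vertex_stab act y).
Proof.
move=> fineX xy; have Xc := rca_connected rca.
have [p [wp minp]] : exists p, geodesic x y p.
  have [p wp sp] := dist_geodesic Xc x y.
  by exists p; apply/(geodesicE Xc).
case: p wp minp => [/walk_last //|w p] wp minp.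
have := fineX x y (size (w :: p)) => /finite_seqP[L LE].
have xw : adj x w by move: wp; rewrite walk_cons => /andP[].
apply: bounded_sub (@bounded_seq _ _ [seq head x q | q <- L]
  (fun w' => [set g | act g x = x /\ act g w = w']) _).
  move=> g [gx gy]; exists (act g w) => //.
  apply/mapP; exists (map (act g) (w :: p)) => //.
  suff : [set` L] (map (act g) (w :: p)) by [].
  have wgp : walk x y (map (act g) (w :: p)).
    by rewrite -{1}gx -{1}gy (act_walk actP).
  rewrite -LE /= size_map; split=> //.
  rewrite /embedded_path wgp /=.
  by apply: (@geodesic_uniq _ x y) => //; split=> // q /minp; rewrite /= size_map.
by move=> w' _; exact: transporter_bounded.
Qed.

Lemma stab_pair_compact x y : fine X -> x <> y ->
  compact (vertex_stab act x `&` vertex_stab act y).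
Proof.
move=> fineX xy; apply: closed_bounded_compact; last exact: stab_pair_bounded.
by apply: closedI; exact: vertex_stab_closed.
Qed.
End RelativeStabilizers.

(** * Coarse primitives *)

Section Cone.
Context (X : graph).
Implicit Types (x y u v : X) (p : seq X).

Lemma walk_sum_cone (w : X -> X -> int) z x p (K : nat) :
  {in x :: p &, forall u v, (`|w z u + w u v - w z v| <= K%:Z)%R} ->
  (`|walk_sum w x p - (w z (last x p) - w z x)| <= (K * size p)%N%:Z)%R.
Proof.
elim: p x => [|y p IH] x cone /=; first by rewrite subrr subr0 normr0.
have h1 : (`|w z x + w x y - w z y| <= K%:Z)%R.
  by apply: cone; rewrite !inE eqxx ?orbT.
have := IH y _; rewrite mulnS => /(_ _)/wrap[|h2]; last by lia.
by move=> u v up vp; apply: cone; rewrite inE ?up ?vp orbT.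
Qed.

Lemma walk_sum_potential (w : X -> X -> int) f (C : nat) x y p :
  (forall x y, adj x y -> (`|w x y - (f y - f x)| <= C%:Z)%R) -> walk x y p ->
  (`|walk_sum w x p - (f y - f x)| <= (C * size p)%N%:Z)%R.
Proof.
move=> wf; elim: p x => [|v p IH] x.
  by rewrite walk_nil => /eqP ->; rewrite /= muln0 subrr subr0.
by rewrite walk_cons => /andP[/wf h1 /IH h2]; rewrite /= mulnS; lia.
Qed.

Lemma walk_diam x y p u v : walk x y p -> u \in x :: p -> v \in x :: p ->
  connected_graph X -> dist u v <= size p.
Proof.
move=> wp up vp Xc; have [p1 [p2 [pE w1 w2]]] := walk_subseq wp up.
move: vp; rewrite pE -cat_cons mem_cat size_cat => /orP[vp|vp].
  by have := walk_mem_dist w1 vp; rewrite (dist_sym Xc u); lia.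
have vp2 : v \in u :: p2 by rewrite inE vp orbT.
by have := walk_mem_dist w2 vp2; lia.
Qed.

End Cone.

Section Primitives.
Context (G : topologicalGroupType).
Implicit Types (A B L : set G) (w : G -> G -> int) (g h x y z : G).

(** The coboundary of [w] is bounded on the triangles of a Rips-type complex on [L], with edges
    given by [B]. *)
Definition almost_cocycle L B (K : nat) w := forall x y z,
  L x -> L y -> L z -> B (x^-1 * y) -> B (y^-1 * z) -> B (x^-1 * z) ->
  (`|w x y + w y z - w x z| <= K%:Z)%R.

(* Vanishing of the coarse [l^infty]-cohomology of [L] in degree 2, the dual
   form of a linear homological isoperimetric inequality. *)
Definition coarse_primitives L := forall A, bounded A ->
  exists2 B, bounded B & forall K, exists C : nat, forall w,
    alternating w -> almost_cocycle L B K w ->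
    exists f : G -> int, forall x y, L x -> L y -> A (x^-1 * y) ->
      (`|w x y - (f y - f x)| <= C%:Z)%R.

(** With [B := L] every triangle in [L] is tested, so coning from 1 gives a primitive. *)
Lemma coarse_primitives_bounded L : is_subgroup L -> bounded L ->
  coarse_primitives L.
Proof.
move=> [L1 LM LV] bL A bA; exists L => // K; exists K => w alt coc.
exists (w 1) => x y Lx Ly _.
have Lxy : L (x^-1 * y) by apply/LM/Ly/LV.
have := coc 1 x y L1 Lx Ly; rewrite invg1 !mul1g => /(_ Lx Lxy Ly); lia.
Qed.

Lemma coarse_primitives_conj L g : coarse_primitives L ->
  coarse_primitives (conj_set g L).
Proof.
move=> QL A bA; have [B bB BP] := QL _ (conj_bounded g^-1 bA).
exists (conj_set g B); first exact: conj_bounded.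
have conjK x : g^-1 * (g * x * g^-1) * g = x by rewrite -!mulgA mulVg mulg1 mulKg.
have conjV x y : (g * x * g^-1)^-1 * (g * y * g^-1) = g * (x^-1 * y) * g^-1.
  by rewrite !invgM invgK -!mulgA mulKg.
move=> K; have [C CP] := BP K; exists C => w alt coc.
have [||f fP] := CP (fun x y => w (g * x * g^-1) (g * y * g^-1)).
- by move=> x y; exact: alt.
- move=> x y z Lx Ly Lz Bxy Byz Bxz.
  apply: coc; rewrite ?conjV;
    by [exists x | exists y | exists z | exists (x^-1 * y) |
        exists (y^-1 * z) | exists (x^-1 * z)].
exists (fun x => f (g^-1 * x * g)) => _ _ [x Lx <-] [y Ly <-] Axy.
rewrite !conjK; apply: fP => //; exists ((g * x * g^-1)^-1 * (g * y * g^-1)) => //.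
by rewrite conjV invgK conjK.
Qed.

Lemma coarse_primitives_translate L B (K : nat) w g :
  almost_cocycle [set: G] B K w ->
  almost_cocycle L B K (fun x y => w (g * x) (g * y)).
Proof.
by move=> coc x y z _ _ _ Bxy Byz Bxz; apply: coc; rewrite // invgM -mulgA mulKg.
Qed.

End Primitives.

Lemma dist_act (G : topologicalGroupType) (X : graph) (act : G -> X -> X)
  g x y : graph_action act -> connected_graph X ->
  dist (act g x) (act g y) = dist x y.
Proof.
move=> actP Xc.
have le h u v : dist (act h u) (act h v) <= dist u v.
  have [p wp <-] := dist_geodesic Xc u v.
  by rewrite -(size_map (act h)) dist_le // (act_walk actP).
by apply/eqP; rewrite eqn_leq le -{1}(actK actP g x) -{1}(actK actP g y) le.
Qed.

Lemma finite_ball (X : graph) (x : X) r : connected_graph X -> locally_finite X ->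
  exists l : seq X, forall y, dist x y <= r -> y \in l.
Proof.
move=> Xc lf; elim: r => [|r [l lP]].
  by exists [:: x] => y; rewrite leqn0 inE => /eqP/(dist_eq0 Xc) ->.
have /choice[nb nbP] y : exists l : seq X, forall z, adj y z -> z \in l.
  have /finite_seqP[s sE] := lf y; exists s => z yz.
  by suff : [set` s] z by []; rewrite -sE.
exists (l ++ flatten (map nb l)) => y.
rewrite leq_eqVlt mem_cat => /orP[/eqP d|]; last first.
  by rewrite ltnS => /lP ->.
have [p wp sp] := dist_geodesic Xc x y; apply/orP; right.
move: wp sp; rewrite d; case/lastP: p => // p z.
rewrite -cats1 walk_cat walk_cons walk_nil size_cat addn1 => /and3P[wp a /eqP zy] [sp].
apply/flatten_mapP; exists (last x p); last by apply: nbP; rewrite -zy.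
by apply: lP; rewrite -sp dist_le.
Qed.

(** * Coarse primitives on open hyperbolic subgroups *)

Section HyperbolicSubgroup.
Context (G : topologicalGroupType) (H : subgroup G).
Hypothesis openH : open (H : set G).
Let T := subgroup_type H.
Definition sg_incl (h : subgroup_type H) : G := val h.

Lemma sg_incl_continuous : continuous sg_incl.
Proof. exact: (@initial_continuous (set_type (subgroup_set H)) G set_val). Qed.

Lemma sg_incl_mem (h : T) : (H : set G) (sg_incl h).
Proof. by have /set_mem := valP h. Qed.

Lemma sg_incl_insubd (g : G) : (H : set G) g -> sg_incl (insubd (1 : T) g) = g.
Proof. by move=> Hg; rewrite /sg_incl insubdK //; exact/mem_set. Qed.

Lemma sg_inclK (h : T) : insubd (1 : T) (sg_incl h) = h.
Proof. exact: valKd. Qed.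

Lemma sg_incl_divl (x y : T) :
  (sg_incl x)^-1 * sg_incl y = sg_incl (x^-1 * y).
Proof. by rewrite /sg_incl gmulfM gmulfV. Qed.

Lemma sg_incl_bounded (A : set T) : bounded A -> bounded (sg_incl @` A).
Proof.
move=> [K cK AK]; exists (sg_incl @` K); last exact: image_subset.
by apply: continuous_compact => //; exact/continuous_subspaceT/sg_incl_continuous.
Qed.

Lemma sg_incl_open (A : set T) : open A -> open (sg_incl @` A).
Proof.
case=> O oO OA; rewrite (_ : sg_incl @` A = O `&` H); first exact: openI.
apply/seteqP; split=> [_ [h Ah <-]|g [Og Hg]].
  by split; [have := Ah; rewrite -OA | exact: sg_incl_mem].
exists (insubd (1 : T) g); last exact: sg_incl_insubd.
by rewrite -OA; suff : O (sg_incl (insubd (1 : T) g)) by []; rewrite sg_incl_insubd.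
Qed.

Context (X : graph) (act : T -> X -> X).
Hypothesis ca : cayley_abels act.
Let Xc : connected_graph X. Proof. by case: ca. Qed.
Let actP : graph_action act. Proof. by case: ca. Qed.
Implicit Types (h : T) (x y : X).

Lemma ball_bounded x r : bounded (sg_incl @` [set h | dist x (act h x) <= r]).
Proof.
apply: sg_incl_bounded; have [_ lf _ _ stabP] := ca.
have [l lP] := finite_ball x r Xc lf.
apply: bounded_sub (@bounded_seq _ _ l (fun y => [set h | act h x = y]) _).
  by move=> h /lP; exists (act h x).
move=> y _; exact/(orbit_map_bounded actP)/compact_bounded/(stabP x).1.
Qed.

Lemma bounded_in_ball (A : set G) x : bounded A ->
  exists r, forall h, A (sg_incl h) -> dist x (act h x) <= r.
Proof.
move=> bA; have [_ _ _ _ stabP] := ca.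
have [|l lP] := bounded_cosets bA (sg_incl_open (stabP x).2).
  by exists 1; [exact: act1 | rewrite /sg_incl gmulf1].
(* Coset representatives in [l] may lie outside [H], where [insubd] returns 1; those that occur
   below lie in [H]. *)
exists (\max_(a <- l) dist x (act (insubd (1%g : T) a) x)) => h /lP[a al [s sx sE]].
have aE : a = sg_incl (h * s^-1).
  have -> : sg_incl (h * s^-1) = sg_incl h * (sg_incl s)^-1.
    by rewrite /sg_incl gmulfM gmulfV.
  by rewrite sE invgM invgK mulVKg.
have -> : act h x = act (insubd (1 : T) a) x.
  by rewrite aE sg_inclK (actM actP) -{2}sx (actK actP).
exact: leq_bigmax_seq al isT.
Qed.

End HyperbolicSubgroup.
Arguments sg_incl {G H} h.

(** A section [s] of the orbit map moves [w] to the vertices of [X]. Coning bounds the result on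
    short circuits, so it has a potential by hyperbolicity, which is then pulled back to [H]. *)
Lemma coarse_primitives_hyperbolic (G : topologicalGroupType) (H : subgroup G) :
  open (H : set G) -> hyperbolic_group (subgroup_type H) ->
  coarse_primitives (H : set G).
Proof.
move=> openH [X [act [ca hypX]]] A bA; set T := subgroup_type H in act ca.
have [Xc _ actP trans _] := ca; have [[x0] _] := Xc.
have [r rP] := bounded_in_ball openH ca x0 bA.
have [N potN] := hyperbolic_potential Xc hypX.
pose ball := [set h : T | dist x0 (act h x0) <= maxn r N].
exists (sg_incl @` ball); first exact: ball_bounded.
(* The potential errs by [K * N * N] on each of at most [r] edges, coning the walk costs [K * r],
   and two triangles pass from [a] and [b] to their section points. *)
move=> K; exists (K * N * N * r + K * r + 2 * K)%N => w alt coc.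
have /choice[s sP] : forall x, exists h, act h x0 = x by move=> x; exact: trans.
have coc' (a b c : T) : dist (act a x0) (act b x0) <= maxn r N ->
    dist (act b x0) (act c x0) <= maxn r N -> dist (act a x0) (act c x0) <= maxn r N ->
    (`|w (sg_incl a) (sg_incl b) + w (sg_incl b) (sg_incl c)
       - w (sg_incl a) (sg_incl c)| <= K%:Z)%R.
  have inB a' b' : dist (act a' x0) (act b' x0) <= maxn r N ->
      (sg_incl @` ball) ((sg_incl a')^-1 * sg_incl b').
    move=> d; rewrite sg_incl_divl; exists (a'^-1 * b') => //.
    by rewrite /ball /= (actM actP) -(dist_act a' _ _ actP Xc) (actVK actP).
  by move=> ab bc ac; apply: coc; try exact: sg_incl_mem; exact: inB.
pose wX x y := w (sg_incl (s x)) (sg_incl (s y)).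
have altX : alternating wX by move=> x y; exact: alt.
have w0 a : w a a = 0%R by have := alt a a; lia.
have cocX u v z : dist u v <= maxn r N -> dist v z <= maxn r N -> dist u z <= maxn r N ->
    (`|wX u v + wX v z - wX u z| <= K%:Z)%R.
  by move=> uv vz uz; apply: coc'; rewrite !sP.
have cone x p : walk x (last x p) p -> size p <= maxn r N ->
    (`|walk_sum wX x p - wX x (last x p)| <= (K * size p)%N%:Z)%R.
  move=> wp sp; have := @walk_sum_cone _ wX x x p K.
  rewrite [wX x x]w0 subr0; apply=> u v up vp.
  by apply: cocX; apply: leq_trans sp; apply: walk_diam wp _ _ Xc; rewrite ?mem_head.
have [|f fP] := potN wX (K * N)%N altX.
  move=> x p /and3P[wp _ _] sp; have := cone x p.
  rewrite (walk_last wp) [wX x x]w0 subr0 => /(_ wp).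
  have : (K * size p <= K * N)%N by rewrite leq_mul2l sp orbT.
  by have : size p <= maxn r N by [lia]; lia.
pose el (g : G) : T := insubd (1 : T) g.
(* The second term accounts for the step from the section point over [act g x0] to [g] itself. *)
exists (fun g => f (act (el g) x0) + w (sg_incl (s (act (el g) x0))) g)%R => g h Hg Hh.
have [gE hE] : g = sg_incl (el g) /\ h = sg_incl (el h) by rewrite !sg_incl_insubd.
rewrite {1}gE {1}hE sg_incl_divl => /rP.
set a := el g in gE *; set b := el h in hE *.
rewrite (actM actP) -(dist_act a _ _ actP Xc) (actVK actP) => dab.
set u := act a x0 in dab *; set v := act b x0 in dab *.
have [p wp sp] := dist_geodesic Xc u v.
have e1 := walk_sum_potential fP wp.
have e2 := cone u p; rewrite (walk_last wp) in e2; have {}e2 := e2 wp ltac:(lia).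
have e3 : (`|w (sg_incl a) (sg_incl (s u)) + wX u v
    - w (sg_incl a) (sg_incl (s v))| <= K%:Z)%R.
  by apply: coc'; rewrite ?sP -/u ?distxx //; lia.
have e4 : (`|w (sg_incl a) (sg_incl (s v)) + w (sg_incl (s v)) (sg_incl b)
    - w (sg_incl a) (sg_incl b)| <= K%:Z)%R.
  by apply: coc'; rewrite ?sP -/u -/v ?distxx //; lia.
have : (K * N * N * size p <= K * N * N * r)%N by rewrite leq_mul2l sp dab orbT.
have : (K * size p <= K * r)%N by rewrite leq_mul2l sp dab orbT.
rewrite gE hE (alt (sg_incl (s u))) in e3 e4 *; lia.
Qed.

(** * From peripheral subgroups to the whole group *)

Section Relative.
Context (G : topologicalGroupType) (X : graph) (act : G -> X -> X).
Context (HH : set (subgroup G)).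
Hypothesis rca : rel_cayley_abels act HH.
Hypothesis fineX : fine X.
Hypothesis hypX : gromov_hyperbolic X.
Hypothesis QHH : forall H : subgroup G, HH H -> coarse_primitives (H : set G).
Implicit Types (x y u v a b : X) (p q : seq X) (g h : G).

Let Xc := rca_connected rca.
Let actP := rca_action rca.

Lemma coarse_primitives_stab v : coarse_primitives (vertex_stab act v).
Proof.
have [cst|[H HH_H [g ->]]] := rca_vertex_stab rca v.
  apply: coarse_primitives_bounded; first exact: vertex_stab_subgroup.
  exact: compact_bounded.
exact/coarse_primitives_conj/QHH.
Qed.

(** Cocompactness moves the first edge of a circuit into a finite list. The rest is an embedded path
    of length less than [N] between the ends of that edge, and fineness leaves finitely many. *)
Lemma circuits_cofinite N : exists W : seq X, forall x p,
  circuit x p -> size p <= N -> exists g, forall u, u \in p -> act g u \in W.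
Proof.
have [_ [s sP]] := rca_cocompact rca.
have /choice[F FP] : forall t : X * X * nat, exists l : seq (seq X), forall p,
    embedded_path t.1.2 t.1.1 p -> size p = t.2 -> p \in l.
  move=> [[a b] k]; have /finite_seqP[l lE] := fineX b a k.
  by exists l => p ep sp; suff : [set` l] p by []; rewrite -lE.
pose W := flatten [seq e.2 :: flatten (flatten [seq F (e, k) | k <- iota 0 N]) | e <- s].
exists W => x [|v p] /and3P[wp up //] _ sp.
have := wp; rewrite walk_cons => /andP[/sP[g gs] wp'].
exists g => u upv; apply/flatten_mapP; exists (act g x, act g v) => //=.
move: upv; rewrite !inE => /orP[/eqP ->|upv]; first by rewrite eqxx.
apply/orP; right; apply/flattenP; exists (map (act g) p); last exact: map_f.
apply/flatten_mapP; exists (size p); first by rewrite mem_iota.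
apply: FP; rewrite /= ?size_map // /embedded_path (act_walk actP) wp'.
by rewrite -map_cons map_inj_uniq //; exact: act_inj.
Qed.

Lemma orbit_representatives : exists rep : X -> X,
  [/\ forall v, exists g, act g (rep v) = v,
      forall g v, rep (act g v) = rep v & exists l : seq X, forall v, rep v \in l].
Proof.
have [[x0] _] := Xc; have [[s sP] _] := rca_cocompact rca.
pose orb v : set X := [set u | exists g, act g u = v].
(* Choosing from the orbit as a set makes [rep] exactly constant on orbits. *)
pose rep v := xget x0 (orb v).
have repP v : exists g, act g (rep v) = v.
  by rewrite /rep; case: xgetP => // /(_ v); case; exists 1; rewrite (act1 actP).
have rep_act g v : rep (act g v) = rep v.
  congr xget; apply/seteqP; split=> u [h hu]; last first.
    by exists (g * h); rewrite (actM actP) hu.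
  by exists (g^-1 * h); rewrite (actM actP) hu (actK actP).
exists rep; split=> //; exists (map rep s) => v.
by have [g gs] := sP v; rewrite -(rep_act g v); exact: map_f.
Qed.

(* Every oriented edge [(v, w)] is carried from its orbit representative by an
   element [tau v w], and [tau] is equivariant up to a bounded error. *)
Lemma edge_transport (rep : X -> X) :
  (forall v, exists g, act g (rep v) = v) -> (forall g v, rep (act g v) = rep v) ->
  exists2 tau : X -> X -> G, forall v w, act (tau v w) (rep v) = v &
  exists2 T0 : set G, bounded T0 & forall g v w, adj v w ->
    T0 ((tau (act g v) (act g w))^-1 * (g * tau v w)).
Proof.
move=> repP rep_act; have [[x0] _] := Xc; have [_ [s sP]] := rca_cocompact rca.
(* The set depends only on the orbit of the oriented edge, so [nb] chooses one edge at [rep v] for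
   the whole orbit. *)
pose nbs v w : set X := [set u | exists g, act g (rep v) = v /\ act g u = w].
pose nb v w := xget x0 (nbs v w).
have nbP v w : exists g, act g (rep v) = v /\ act g (nb v w) = w.
  rewrite /nb; case: xgetP => // none; have [g gv] := repP v.
  by case: (none (act g^-1 w)); exists g; rewrite (actVK actP).
have nb_act g v w : nb (act g v) (act g w) = nb v w.
  congr xget; apply/seteqP; split=> u [h []]; rewrite ?rep_act => hv hu; last first.
    by exists (g * h); rewrite rep_act !(actM actP) hv hu.
  by exists (g^-1 * h); rewrite !(actM actP) hv hu !(actK actP).
have /choice[t tP] : forall e : X * X, exists g,
    act g (rep e.1) = e.1 /\ act g (nb e.1 e.2) = e.2.
  by move=> e; exact: nbP.
exists (fun v w => t (v, w)); first by move=> v w; exact: (tP (v, w)).1.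
(* The failure of equivariance of [t] fixes both [rep v] and [nb v w]; finitely many such pairs
   arise from edges. *)
pose F (e : X * X) := [set g | act g (rep e.1) = rep e.1 /\ act g (nb e.1 e.2) = nb e.1 e.2].
exists [set g | exists2 e, e \in [seq e <- s | adj e.1 e.2] & F e g].
  apply: bounded_seq => -[a b]; rewrite mem_filter /= => /andP[ab _].
  have [g [ga gb]] := nbP a b; apply: (transporter_bounded rca).
  by rewrite -(act_adj actP g) ga gb.
move=> g v w vw; have [h hs] := sP _ _ vw.
exists (act h v, act h w); first by rewrite mem_filter hs (act_adj actP) vw.
have [t1 t2] := tP (v, w); have [/= t3 t4] := tP (act g v, act g w).
rewrite rep_act nb_act in t3 t4.
rewrite /F /= rep_act nb_act !(actM actP) t1 t2 /=.
by split; apply: (act_inj actP (g := t (act g v, act g w))); rewrite (actVK actP) ?t3 ?t4.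
Qed.

(** The fibre over [v] is a left coset of the stabilizer of [rep v], so a primitive on the
    stabilizer can be translated to it. As [rep] takes finitely many values, [B] and [C] can be
    chosen uniformly in [v]. *)
Lemma coarse_primitives_fibres (rep : X -> X) (A : set G) :
  (forall v, exists g, act g (rep v) = v) -> (exists l : seq X, forall v, rep v \in l) ->
  bounded A -> exists2 B, bounded B & forall K, exists C : nat, forall w,
    alternating w -> almost_cocycle [set: G] B K w ->
    forall v, exists f : G -> int, forall g h,
      act g (rep v) = v -> act h (rep v) = v -> A (g^-1 * h) ->
      (`|w g h - (f h - f g)| <= C%:Z)%R.
Proof.
move=> repP [l lP] bA.
suff [B bB BP] : exists2 B, bounded B & forall K, exists C : nat, forall w,
    alternating w -> almost_cocycle [set: G] B K w ->
    forall v, rep v \in l -> exists f : G -> int, forall g h,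
      act g (rep v) = v -> act h (rep v) = v -> A (g^-1 * h) ->
      (`|w g h - (f h - f g)| <= C%:Z)%R.
  by exists B => // K; have [C CP] := BP K; exists C => w alt coc v; exact: CP.
elim: l {lP} => [|u l [B1 bB1 B1P]]; first by exists A => // K; exists 0%N.
have [B2 bB2 B2P] := coarse_primitives_stab u bA.
exists (B1 `|` B2); first exact: boundedU.
move=> K; have [C1 C1P] := B1P K; have [C2 C2P] := B2P K.
exists (maxn C1 C2) => w alt coc v; rewrite inE => /orP[/eqP vu|vl]; last first.
  have [|f fP] := C1P w alt _ v vl; last first.
    by exists f => g h gv hv Agh; apply: le_trans (fP _ _ gv hv Agh) _; rewrite lez_nat leq_maxl.
  by move=> x y z Lx Ly Lz Bxy Byz Bxz; apply: coc => //; left.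
have [s sv] := repP v.
have coc2 : almost_cocycle (vertex_stab act u) B2 K (fun x y : G => w (s * x) (s * y)).
  apply: coarse_primitives_translate => x y z Lx Ly Lz Bxy Byz Bxz.
  by apply: coc => //; right.
have [|f fP] := C2P _ _ coc2; first by move=> x y; exact: alt.
exists (fun g => f (s^-1 * g)) => g h gv hv Agh.
have L k : act k (rep v) = v -> vertex_stab act u (s^-1 * k).
  by move=> kv; rewrite /vertex_stab /= -vu (actM actP) kv -{1}sv (actK actP).
have := fP _ _ (L _ gv) (L _ hv); rewrite !mulVKg invgM invgK -mulgA mulVKg.
by move=> /(_ Agh) le; apply: le_trans le _; rewrite lez_nat leq_maxr.
Qed.

Section FlagWalk.
Variables (rep : X -> X) (tau : X -> X -> G) (w : G -> G -> int).
Variables (f : X -> G -> int) (P : set G) (K C : nat).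
Hypothesis tauP : forall v u, act (tau v u) (rep v) = v.
Hypothesis cone : forall x y z : G, P x -> P y -> P z ->
  (`|w x y + w y z - w x z| <= K%:Z)%R.
Hypothesis corner : forall v (x y : G), P x -> P y ->
  act x (rep v) = v -> act y (rep v) = v ->
  (`|w x y - (f v y - f v x)| <= C%:Z)%R.

(** A lifted walk crosses an edge from [tau v u] to [tau u v], then turns within the fibre over [u].
    The turns are nearly differences of [f u], and their two terms are attributed to the adjacent
    edges. *)
Definition edge_form (v u : X) : int :=
  (w (tau v u) (tau u v) + f v (tau v u) - f u (tau u v))%R.

(** Everything is coned to [y]: each edge costs two triangles and one turn, and a last turn remains
    at the end. *)
Lemma flag_walk p v (x y : G) : walk v (last v p) p ->
  {in v :: p &, forall a b, adj a b -> P (tau a b)} -> P x -> P y ->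
  act x (rep v) = v -> act y (rep (last v p)) = last v p ->
  (`|w x y - (walk_sum edge_form v p + f (last v p) y - f v x)|
     <= ((C + 2 * K) * size p + C)%N%:Z)%R.
Proof.
elim: p v x => [|u p IH] v x /=.
  by move=> _ _ Px Py xv yv; rewrite add0r muln0; exact: corner.
rewrite walk_cons => /andP[vu wp] Pt Px Py xv yl.
have [Pvu Puv] : P (tau v u) /\ P (tau u v).
  by split; apply: Pt; rewrite ?inE ?eqxx ?orbT // adj_sym.
have h := IH u (tau u v) wp _ Puv Py (tauP u v) yl.
move: h => /(_ _)/wrap[|h].
  by move=> a b ap bp; apply: Pt; rewrite inE ?ap ?bp orbT.
have := cone Px Pvu Py; have := cone Pvu Puv Py; have := corner Px Pvu xv (tauP v u).
rewrite mulnS {1}/edge_form; lia.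
Qed.

End FlagWalk.

(** By almost equivariance, the lifts of edges within a translate of a finite set stay in the same
    translate of a bounded set. *)
Lemma flags_bounded (tau : X -> X -> G) T0 (W : seq X) : bounded T0 ->
  (forall g v u, adj v u -> T0 ((tau (act g v) (act g u))^-1 * (g * tau v u))) ->
  exists2 M, bounded M & forall g v u, v \in W -> u \in W -> adj v u ->
    M (g^-1 * tau (act g v) (act g u)).
Proof.
move=> bT0 T0P.
pose F (e : X * X) := [set x * y | x in [set tau e.1 e.2] & y in [set t^-1 | t in T0]].
exists [set g | exists2 e, e \in [seq (v, u) | v <- W, u <- W] & F e g].
  by apply: bounded_seq => e _; exact/boundedM/boundedV/bT0/bounded1.
move=> g v u vW uW vu; exists (v, u); first by apply/allpairsP; exists (v, u).
exists (tau v u) => //; set t := tau (act g v) (act g u).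
exists (t^-1 * (g * tau v u))^-1; first by exists (t^-1 * (g * tau v u)) => //; exact: T0P.
by rewrite !invgM invgK -!mulgA mulVKg.
Qed.

Lemma coarse_primitives_relative : coarse_primitives [set: G].
Proof.
have [[x0] conn] := Xc.
(* Without edges, connectedness leaves a single vertex, stabilized by all of [G]. *)
have [[a [b ab]]|noedge] := pselect (exists a b : X, adj a b); last first.
  rewrite (_ : [set: G] = vertex_stab act x0); first exact: coarse_primitives_stab.
  apply/seteqP; split=> // g _; have [[|v p] wp] := conn (act g x0) x0.
    by move: wp; rewrite walk_nil => /eqP.
  by move: wp; rewrite walk_cons => /andP[e _]; case: noedge; exists (act g x0), v.
move=> A bA.
have [rep [repP rep_act repl]] := orbit_representatives.
have [tau tauP [T0 bT0 T0P]] := edge_transport repP rep_act.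
have [N potN] := hyperbolic_potential Xc hypX.
have [W1 W1P] := circuits_cofinite N.
have [la laP] := orbit_finite actP ((rca_discrete rca).1 a) bA.
have [lb lbP] := orbit_finite actP ((rca_discrete rca).1 b) bA.
have /choice[q qP] : forall c, exists p, walk a c p by move=> c; exact: conn.
pose r := \max_(c <- la) size (q c).
(* Up to translation, [W] contains all short circuits, the base edge with its images under [A], and
   walks from [a] to its images. *)
pose W := W1 ++ a :: b :: lb ++ la ++ flatten (map q la).
have [M0 bM0 M0P] := flags_bounded W bT0 T0P.
(* A translate of [M] by [x] contains [x], its [A]-neighbours and the lifts of edges in the
   translate of [W]; [B1] collects the differences within one translate. *)
pose M := [set 1] `|` A `|` M0.
have bM : bounded M by apply: boundedU bM0; apply: boundedU bA; exact: bounded1.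
pose B1 := [set x * y | x in [set t^-1 | t in M] & y in M].
have bB1 : bounded B1 by exact/boundedM/bM/boundedV.
have [B2 bB2 B2P] := coarse_primitives_fibres repP repl bB1.
exists (B1 `|` B2); first exact: boundedU.
move=> K; have [C CP] := B2P K.
pose K1 := ((C + 2 * K) * N + C)%N.
(* The terms are the error of [psi] along a walk of length at most [r], the error of [flag_walk]
   along it, and two triangles joining its end lifts to [x] and [y]. *)
exists (K1 * N * r + ((C + 2 * K) * r + C) + 2 * K)%N => w alt coc.
have /choice[f fP] := CP w alt (fun (x y z : G) Lx Ly Lz Bxy Byz Bxz =>
  coc x y z Lx Ly Lz (or_intror Bxy) (or_intror Byz) (or_intror Bxz)).
pose P g := [set h | M (g^-1 * h)].
have PB1 g (x y : G) : P g x -> P g y -> B1 (x^-1 * y).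
  move=> Px Py; exists (g^-1 * x)^-1; first by exists (g^-1 * x).
  by exists (g^-1 * y) => //; rewrite invgM invgK -mulgA mulVKg.
have cone g (x y z : G) : P g x -> P g y -> P g z ->
    (`|w x y + w y z - w x z| <= K%:Z)%R.
  by move=> Px Py Pz; apply: coc => //; left; exact: (PB1 g).
have corner g v (x y : G) : P g x -> P g y -> act x (rep v) = v -> act y (rep v) = v ->
    (`|w x y - (f v y - f v x)| <= C%:Z)%R.
  by move=> Px Py xv yv; apply: fP => //; exact: (PB1 g).
have tau_in g v u : v \in W -> u \in W -> adj v u -> P g (tau (act g v) (act g u)).
  by move=> vW uW vu; right; exact: M0P.
pose wX := edge_form tau w f.
have altX : alternating wX by move=> v u; rewrite /wX /edge_form (alt (tau u v)); lia.
have w0 (x : G) : w x x = 0%R by have := alt x x; lia.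
have flags := fun g => flag_walk tauP (cone g) (corner g).
have [|psi psiP] := potN wX K1 altX.
  move=> x p cp sp; have [g gW] := W1P _ _ cp sp.
  have /and3P[wp _ _] := cp.
  case: p cp sp gW wp => [|v p] cp sp gW wp; first by move: cp; rewrite /circuit andbF.
  have lp := walk_last wp; have xv : adj x v by move: wp; rewrite walk_cons => /andP[].
  have gW' u : u \in x :: v :: p -> act g u \in W.
    rewrite inE mem_cat => /orP[/eqP ->|/gW -> //].
    by rewrite gW // -lp /= mem_last.
  have tau_in' : {in x :: v :: p &, forall c d, adj c d -> P g^-1 (tau c d)}.
    move=> c d cp' dp cd; rewrite -(actK actP g c) -(actK actP g d).
    by apply: tau_in; rewrite ?gW' // (act_adj actP).
  have Pxv : P g^-1 (tau x v) by apply: tau_in'; rewrite ?inE ?eqxx ?orbT.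
  (* Since the lifted walk starts and ends at the same lift, its [w]-term vanishes and the [f]-terms
     cancel, leaving the sum around the circuit. *)
  have := flags _ (v :: p) x (tau x v) (tau x v) _ tau_in' Pxv Pxv (tauP x v).
  rewrite lp w0 => /(_ wp (tauP x v)).
  have : ((C + 2 * K) * size (v :: p) <= (C + 2 * K) * N)%N by rewrite leq_mul2l sp orbT.
  by rewrite -/wX /K1; lia.
(* The potential is followed from the vertex [act g a] to the lift of the translated base edge, and
   from there to [g]. *)
pose phi g : int := (psi (act g a) + f (act g a) (tau (act g a) (act g b)) +
  w (tau (act g a) (act g b)) g)%R.
exists phi => x y _ _ Axy'.
have [s Axy yE] : exists2 s, A s & y = x * s by exists (x^-1 * y); rewrite ?mulVKg.
have [aW bW] : a \in W /\ b \in W by rewrite !mem_cat !inE !eqxx !orbT.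
have [saW sbW] : act s a \in W /\ act s b \in W.
  by rewrite !mem_cat !inE !mem_cat laP // lbP // !orbT.
have Px : P x x by left; left; rewrite /= mulVg.
have Py : P x y by left; right; rewrite yE mulKg.
pose t1 := tau (act x a) (act x b); pose t2 := tau (act y a) (act y b).
have Pt1 : P x t1 by exact: tau_in.
have Pt2 : P x t2 by rewrite /t2 yE !(actM actP); apply: tau_in; rewrite ?(act_adj actP).
have := qP (act s a); set p := q _ => wp.
have pW : {subset a :: p <= W}.
  move=> c; rewrite inE => /orP[/eqP -> //|cp].
  rewrite !mem_cat !inE !mem_cat; suff -> : c \in flatten (map q la) by rewrite !orbT.
  by apply/flatten_mapP; exists (act s a); [exact: laP|].
have sp : size p <= r.
  exact: (@leq_bigmax_seq _ la xpredT (fun c => size (q c)) _ (laP _ Axy) isT).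
have wp' : walk (act x a) (act y a) (map (act x) p).
  by rewrite yE (actM actP) (act_walk actP).
have lp := walk_last wp'.
have tau_in' : {in act x a :: map (act x) p &, forall c d, adj c d -> P x (tau c d)}.
  move=> c d; rewrite -map_cons => /mapP[c' /pW c'W ->] /mapP[d' /pW d'W ->].
  by rewrite (act_adj actP) => cd; exact: tau_in.
have := flags _ (map (act x) p) (act x a) t1 t2 _ tau_in' Pt1 Pt2 (tauP _ _).
rewrite lp size_map => /(_ wp' (tauP _ _)) h1.
have := walk_sum_potential psiP wp'; rewrite size_map => h2.
have h3 := cone _ _ _ _ Px Pt1 Py; have h4 := cone _ _ _ _ Pt1 Pt2 Py.
have : ((C + 2 * K) * size p <= (C + 2 * K) * r)%N by rewrite leq_mul2l sp orbT.
have : (K1 * N * size p <= K1 * N * r)%N by rewrite leq_mul2l sp orbT.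
rewrite -/wX (alt x t1) in h1 h3 *; rewrite /phi -/t1 -/t2; lia.
Qed.

End Relative.

(** * The coset graph *)

Section Hyperbolicity.
Context (G : topologicalGroupType) (X : graph) (act : G -> X -> X).
Hypothesis ca : cayley_abels act.
Let Xc : connected_graph X. Proof. by case: ca. Qed.
Let actP : graph_action act. Proof. by case: ca. Qed.

Lemma lipschitz_dist (f : X -> int) x y : lipschitz f ->
  (`|f x - f y| <= (dist x y)%:Z)%R.
Proof.
move=> lf; have [p wp <-] := dist_geodesic Xc x y.
elim: p x wp => [|v p IH] x; first by rewrite walk_nil => /eqP ->; rewrite subrr.
by rewrite walk_cons => /andP[/lf h1 /IH h2] /=; lia.
Qed.

(** The coboundary is a determinant in the increments of [f] and [g], so its bound is independent of
    the size of their values. *)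
Lemma area_form_cocycle (f g : X -> int) x y z (R : nat) :
  lipschitz f -> lipschitz g -> dist x y <= R -> dist y z <= R ->
  (`|area_form f g x y + area_form f g y z - area_form f g x z|
    <= (2 * R * R)%N%:Z)%R.
Proof.
move=> lf lg xy yz.
have [h1 h2] := (lipschitz_dist x y lf, lipschitz_dist y z lf).
have [h3 h4] := (lipschitz_dist x y lg, lipschitz_dist y z lg).
have -> : (area_form f g x y + area_form f g y z - area_form f g x z =
  (f x - f y) * (g y - g z) - (g x - g y) * (f y - f z))%R.
  by rewrite /area_form; lia.
have mul (a b : int) : (`|a| <= R%:Z -> `|b| <= R%:Z -> `|a * b| <= (R * R)%N%:Z)%R.
  by move=> aR bR; rewrite normrM PoszM ler_pM.
rewrite -lez_nat in xy; rewrite -lez_nat in yz.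
have h5 := mul _ _ (le_trans h1 xy) (le_trans h4 yz).
have h6 := mul _ _ (le_trans h3 xy) (le_trans h2 yz).
rewrite -mulnA; lia.
Qed.

(** The area forms of all pairs of Lipschitz functions, pulled back to [G], are almost cocycles with
    one constant. Their primitives telescope around closed walks, which gives the linear area
    bound. *)
Lemma cayley_abels_hyperbolic : coarse_primitives [set: G] -> gromov_hyperbolic X.
Proof.
have [_ lf _ trans stabP] := ca; have [[x0] _] := Xc => prim.
have bA : bounded [set g | adj x0 (act g x0)].
  have /finite_seqP[l lE] := lf x0.
  apply: bounded_sub (@bounded_seq _ _ l (fun y => [set g | act g x0 = y]) _).
    move=> g ag; exists (act g x0) => //.
    by suff : [set` l] (act g x0) by []; rewrite -lE.
  by move=> y _; exact/(orbit_map_bounded actP)/compact_bounded/(stabP x0).1.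
have [B bB BP] := prim _ bA.
have [l lP] := orbit_finite actP (stabP x0).2 bB.
pose R := \max_(y <- l) dist x0 y.
have [C CP] := BP (2 * R * R)%N.
apply: (@area_linear_slim _ Xc C) => f g lipf lipg.
have /choice[s sP] : forall x, exists h, act h x0 = x by move=> x; exact: trans.
have BR x y : B (x^-1 * y) -> dist (act x x0) (act y x0) <= R.
  move=> /lP; rewrite (actM actP) => xyl.
  rewrite -(dist_act x^-1 _ _ actP Xc) (actK actP).
  exact: (@leq_bigmax_seq _ l xpredT (dist x0) _ xyl isT).
have [||phi phiP] := CP (fun x y => area_form f g (act x x0) (act y x0)).
- by move=> x y; rewrite /area_form; lia.
- by move=> x y z _ _ _ /BR xy /BR yz _; exact: area_form_cocycle.
move=> x p wp; have := @walk_sum_potential _ (area_form f g) (phi \o s) C x x p _ wp.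
rewrite subrr subr0; apply => u v uv /=.
have := phiP (s u) (s v) I I; rewrite !sP; apply.
by rewrite /= (actM actP) -(act_adj actP (s u)) (actVK actP) !sP.
Qed.

End Hyperbolicity.

Section CosetGraph.
Context (G : topologicalGroupType) (U K : set G).
Implicit Types (g h x y : G).

(** Left cosets are kept as sets, so that equality of vertices is equality of cosets. *)
Definition is_coset (A : set G) : bool :=
  `[< exists g, A = [set g * u | u in U] >].
Definition coset := {A : set G | is_coset A}.
HB.instance Definition _ := Choice.on coset.

Fact is_coset_mul g : is_coset [set g * u | u in U].
Proof. by apply/asboolP; exists g. Qed.

Definition mkcoset g : coset := exist (fun A : set G => is_coset A) _ (is_coset_mul g).

Lemma mkcoset_surj (A : coset) : exists g, A = mkcoset g.
Proof. by case: A => A cA; have /asboolP[g E] := cA; exists g; exact: val_inj. Qed.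

(** For a subgroup [U], distinct [gU] and [hU] are adjacent exactly when [g^-1 * h] lies in the
    double coset set of [U] generated by [K] and its inverses. *)
Definition coset_adj : rel coset := fun A B => (A != B) &&
  `[< exists x y, [/\ val A x, val B y & K (x^-1 * y) \/ K (y^-1 * x)] >].

Fact coset_adj_sym : symmetric coset_adj.
Proof.
move=> A B; rewrite /coset_adj eq_sym; congr andb; apply: asbool_equiv_eq.
by split=> -[x [y [xA yB xy]]]; exists y, x; split=> //; case: xy => ?; by [right | left].
Qed.

Fact coset_adj_irrefl : irreflexive coset_adj.
Proof. by move=> A; rewrite /coset_adj eqxx. Qed.

Definition coset_graph := Graph coset_adj_sym coset_adj_irrefl.

Fact is_coset_act g (A : coset) : is_coset [set g * x | x in val A].
Proof.
have [h ->] := mkcoset_surj A; apply/asboolP; exists (g * h).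
apply/seteqP; split=> [_ [_ [u Uu <-] <-]|_ [u Uu <-]].
  by exists u; rewrite ?mulgA.
by exists (h * u); [exists u | rewrite mulgA].
Qed.

Definition coset_act g (A : coset_graph) : coset_graph :=
  exist (fun A : set G => is_coset A) _ (is_coset_act g A).

Lemma coset_act_mk g h : coset_act g (mkcoset h) = mkcoset (g * h).
Proof.
apply: val_inj => /=; apply/seteqP; split=> [_ [_ [u Uu <-] <-]|_ [u Uu <-]].
  by exists u; rewrite ?mulgA.
by exists (h * u); [exists u | rewrite mulgA].
Qed.

Hypothesis subU : is_subgroup U.

Lemma mkcoset_eq g h : mkcoset g = mkcoset h <-> U (g^-1 * h).
Proof.
have [U1 UM UV] := subU; split=> [E|Ugh].
  have : val (mkcoset h) h by exists 1; rewrite ?mulg1.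
  by rewrite -E => -[u Uu <-]; rewrite mulKg.
apply: val_inj; apply/seteqP; split=> _ [u Uu <-] /=.
  exists ((g^-1 * h)^-1 * u); first exact/UM/Uu/UV.
  by rewrite invgM invgK -mulgA mulVKg.
by exists (g^-1 * h * u); [exact: UM | rewrite -mulgA mulVKg].
Qed.

Lemma mkcoset_mem (A : coset) g : val A g -> A = mkcoset g.
Proof.
have [h ->] := mkcoset_surj A => -[u Uu <-]; apply/mkcoset_eq.
by rewrite mulKg.
Qed.

Lemma coset_action : graph_action coset_act.
Proof.
split.
- by move=> A; have [g ->] := mkcoset_surj A; rewrite coset_act_mk mul1g.
- by move=> g h A; have [k ->] := mkcoset_surj A; rewrite !coset_act_mk mulgA.
- move=> g A B; rewrite /adj /= /coset_adj.
  have inj : injective (coset_act g).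
    apply: (@can_inj _ _ _ (coset_act g^-1)) => C; have [h ->] := mkcoset_surj C.
    by rewrite !coset_act_mk mulKg.
  rewrite (inj_eq inj); congr andb; apply: asbool_equiv_eq; split.
    case=> _ [_ [[x xA <-] [y yB <-] xy]]; exists x, y; split=> //.
    by move: xy; rewrite !invgM -!mulgA !mulKg.
  case=> x [y [xA yB xy]]; exists (g * x), (g * y).
  by split; [exists x | exists y | rewrite !invgM -!mulgA !mulKg].
Qed.

Hypothesis openU : open U.
Hypothesis cptU : compact U.
Hypothesis cptK : compact K.
Hypothesis genK : smallest (@is_subgroup G) K = setT.

Lemma coset_connected : connected_graph coset_graph.
Proof.
split; first by exists; exact: (mkcoset 1).
(* Translating walks shows that [D] is a subgroup; it contains the generating set [K]. *)
pose D := [set g | exists p, @walk coset_graph (mkcoset 1) (mkcoset g) p].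
have tr g h k p : @walk coset_graph (mkcoset h) (mkcoset k) p ->
    exists q, @walk coset_graph (mkcoset (g * h)) (mkcoset (g * k)) q.
  move=> wp; exists (map (coset_act g) p).
  by rewrite -!coset_act_mk (act_walk coset_action).
have DT g : D g.
  have : smallest (@is_subgroup G) K g by rewrite genK.
  apply: smallest_sub; first split.
  - by exists [::]; rewrite walk_nil.
  - move=> x y [p wp] [q /(tr x)[q' wq]]; exists (p ++ q').
    by apply: walk_trans wp _; rewrite mulg1 in wq.
  - move=> x [p /walk_rev[q [wq _ _]]]; have [r wr] := tr x^-1 _ _ _ wq.
    by exists r; rewrite mulVg mulg1 in wr.
  - move=> k Kk; have [E|nE] := eqVneq (mkcoset 1) (mkcoset k).
      by exists [::]; rewrite walk_nil E.
    exists [:: mkcoset k]; rewrite walk_cons walk_nil eqxx andbT.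
    apply/andP; split=> //; apply/asboolP; exists 1, k; have [U1 _ _] := subU.
    by split; [exists 1; rewrite ?mulg1 | exists 1; rewrite ?mulg1 | left; rewrite invg1 mul1g].
move=> A B; have [g ->] := mkcoset_surj A; have [h ->] := mkcoset_surj B.
have [p wp] := DT (g^-1 * h); have [q wq] := tr g _ _ _ wp.
by exists q; rewrite mulg1 mulVKg in wq.
Qed.

Lemma coset_graph_cayley_abels : cayley_abels coset_act.
Proof.
have [U1 UM UV] := subU; split; [exact: coset_connected| |exact: coset_action| |].
- move=> A; have [g ->] := mkcoset_surj A.
  (* Every neighbour of the coset of [g] meets the bounded set [N], which finitely many cosets of
     the open subgroup [U] cover. *)
  pose N := [set x * y | x in [set g * u | u in U] & y in K `|` [set k^-1 | k in K]].
  have bN : bounded N.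
    apply: boundedM; last exact/boundedU/boundedV/compact_bounded/cptK/compact_bounded.
    apply: (bounded_translate (g := g^-1) (compact_bounded cptU)).
    by move=> _ [u Uu <-]; rewrite mulKg.
  have [l lP] := bounded_cosets bN openU U1.
  apply: (@sub_finite_set _ _ [set` map mkcoset l]); last exact: finite_seq.
  move=> B /andP[_ /asboolP[x [y [xA yB xy]]]].
  have [|h hl Uhy] := lP y.
    exists x => //; exists (x^-1 * y); last by rewrite mulVKg.
    case: xy => xy; [by left | right; exists (y^-1 * x) => //].
    by rewrite invgM invgK.
  rewrite (mkcoset_mem yB); suff <- : mkcoset h = mkcoset y by exact: map_f.
  exact/mkcoset_eq.
- move=> A B; have [g ->] := mkcoset_surj A; have [h ->] := mkcoset_surj B.
  by exists (h * g^-1); rewrite coset_act_mk mulgVK.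
move=> A; have [g ->] := mkcoset_surj A.
have -> : vertex_stab coset_act (mkcoset g) = conj_set g U.
  rewrite -(mulg1 g) -coset_act_mk (vertex_stab_act coset_action) mulg1; congr conj_set.
  apply/seteqP; split=> h; rewrite /vertex_stab /= coset_act_mk mulg1 => Uh.
    by have /esym/mkcoset_eq := Uh; rewrite invg1 mul1g.
  by apply/esym/mkcoset_eq; rewrite invg1 mul1g.
split; first exact: conj_compact.
exact: conj_open.
Qed.

End CosetGraph.

(** A vertex stabilizer in a Cayley-Abels graph of [H] is compact and open in [H], and so also in
    [G]. *)
Lemma hyperbolic_compact_open (G : topologicalGroupType) (H : subgroup G) :
  open (H : set G) -> hyperbolic_group (subgroup_type H) ->
  exists U : set G, [/\ is_subgroup U, open U & compact U].
Proof.
move=> openH [X [act [[[[x0] _] _ actP _ stabP] _]]].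
exists (sg_incl @` vertex_stab act x0); split.
- have [S1 SM SV] := vertex_stab_subgroup actP x0; split.
  + by exists 1; [exact: act1 | rewrite /sg_incl gmulf1].
  + move=> _ _ [x Sx <-] [y Sy <-]; exists (x * y); first exact: SM.
    by rewrite /sg_incl gmulfM.
  + by move=> _ [x Sx <-]; exists x^-1; [exact: SV | rewrite /sg_incl gmulfV].
- exact: sg_incl_open (stabP x0).2.
- apply: continuous_compact (stabP x0).1.
  exact/continuous_subspaceT/sg_incl_continuous.
Qed.

(** * Conclusions for relatively hyperbolic groups *)

Lemma relatively_hyperbolic_hyperbolic (G : topologicalGroupType)
    (HH : set (subgroup G)) :
  compactly_generated G -> relatively_hyperbolic HH ->
  (forall H, HH H -> hyperbolic_group (subgroup_type H)) -> hyperbolic_group G.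
Proof.
move=> [K cptK genK] [[_ openHH _] [X [act [rca fineX hypX]]]] hypHH.
have prim : coarse_primitives [set: G].
  apply: (coarse_primitives_relative rca fineX hypX) => H HH_H.
  exact: coarse_primitives_hyperbolic (openHH _ HH_H) (hypHH _ HH_H).
have [U [subU openU cptU]] :
    exists U : set G, [/\ is_subgroup U, open U & compact U].
  have [[x0] _] := rca_connected rca.
  have [cst|[H HH_H _]] := rca_vertex_stab rca x0.
    exists (vertex_stab act x0); split=> //; last exact: (rca_discrete rca).1.
    exact: vertex_stab_subgroup (rca_action rca) _.
  exact: hyperbolic_compact_open (openHH _ HH_H) (hypHH _ HH_H).
have ca := coset_graph_cayley_abels subU openU cptU cptK genK.
by exists (coset_graph U K), (coset_act (K := K)); split=> //;
  exact: cayley_abels_hyperbolic ca prim.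
Qed.

(** With [H] and [K] the stabilizers of [x] and [y], the conjugate of [H] stabilizes [act g x], and
    distinct vertices have compact common stabilizer. If [act g x = y] while [H] and [K] differ,
    they are conjugate, and properness of the pair makes [K] compact. *)
Lemma peripheral_intersection (G : topologicalGroupType)
    (HH : set (subgroup G)) (H K : subgroup G) (g : G) :
  relatively_hyperbolic HH -> HH H -> HH K ->
  ((H : set G) = K -> ~ (H : set G) g) -> compact (conj_set g H `&` K).
Proof.
move=> [[_ openHH properHH] [X [act [rca fineX hypX]]]] HH_H HH_K gH.
have actP := rca_action rca.
have pair (x y : X) : act g x <> y -> vertex_stab act x = H ->
    vertex_stab act y = K -> compact (conj_set g H `&` K).
  move=> xy <- <-; rewrite -(vertex_stab_act actP).
  exact: stab_pair_compact rca _ _ fineX xy.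
have [x xH] := rca_peripheral rca HH_H; have [y yK] := rca_peripheral rca HH_K.
have [E|nE] := pselect ((H : set G) = K).
  (* One vertex serves for both subgroups here, since [y] might be another vertex with the same
     stabilizer. *)
  by apply: (pair x x); rewrite -?E // => gx; case: (gH E); rewrite -xH.
have [xy|xy] := pselect (act g x = y); last exact: pair xy xH yK.
have HK : conj_set g H = K by rewrite -xH -yK -(vertex_stab_act actP) xy.
rewrite HK setIid; apply: contrapT => ncK.
apply: (properHH H K HH_H HH_K nE _ ncK); last by exists g.
by move=> cH; apply: ncK; rewrite -HK; exact: conj_compact.
Qed.

(** Injectivity of [H] and [1 < n] say that the collection has distinct members and at least two of
    them; the intersection of a single member is that member, which may fail to be compact. *)
Theorem theorem1p4 (G : topologicalGroupType) (tdlcG : tdlc G)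
    (cgG : compactly_generated G) (n : nat) (H : 'I_n -> subgroup G)
    (injH : injective (fun i => H i : set G))
    (openH : forall i, open (H i : set G))
    (cgH : forall i, compactly_generated (subgroup_type (H i)))
    (hypGH : relatively_hyperbolic (range H)) :
  [/\ (forall i j, i <> j -> compact ((H i : set G) `&` H j)) /\
      ((1 < n)%N -> compact (\bigcap_i (H i : set G))),
      (forall i j (g : G), ~ (H i : set G) g ->
        compact (conj_set g (H i) `&` H j))
    & (forall i, hyperbolic_group (subgroup_type (H i))) ->
      hyperbolic_group G].
Proof.
have rangeH i : range H (H i) by exists i.
have meet i j : i <> j -> compact ((H i : set G) `&` H j).
  move=> ij; have := @peripheral_intersection _ _ _ _ 1 hypGH (rangeH i) (rangeH j).
  rewrite (_ : conj_set 1 (H i) = H i); last first.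
    by apply/seteqP; split=> [_ [x Hx <-]|x Hx]; [|exists x => //];
      rewrite invg1 mulg1 mul1g.
  by apply=> /injH.
have closedH i : closed (H i : set G).
  exact: open_subgroup_closed (subgroupP (H i)) (openH i).
split; first split=> [//|n1].
- pose i0 := Ordinal (ltnW n1); pose i1 := Ordinal n1.
  have cpt : compact ((H i0 : set G) `&` H i1) by apply: meet => /(congr1 val).
  apply: subclosed_compact cpt _; first by apply: closed_bigI => i _.
  by move=> x Hx; split; exact: Hx.
- move=> i j g gH; apply: peripheral_intersection hypGH _ _ _ => //.
- move=> hypH; apply: relatively_hyperbolic_hyperbolic hypGH _ => // _ [i _ <-].
  exact: hypH.
Qed.
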